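(* Let $U$ be a space whose one-point compactification $U^*$ is equipped with a finite cell (CW) structure for which the added point $*$ is the only $0$-cell, and let $N$ be a finite set of size $n\ge 0$. Then the pair $((U^* )^N, D_N(U))$ is $(n-1)$-connected. In fact, it has the structure of a relative finite cell complex with cells of dimension $\ge n$ only, such that the $n$-cells of $\mathrm{Conf}_N(U)$ are the connected components of $\mathrm{Conf}_N$ of the union of the $1$-cells in $U$ and, more generally, for every $d\ge 0$ every $(n+d)$-cell of $\mathrm{Conf}_N(U)$ is contained in $\mathrm{Conf}_N$ of the $(d+1)$-skeleton of $U$.
   Context: For a finite set $N$, $\mathrm{Conf}_N(U)$ denotes the space of injective maps $N\to U$ (a singleton if $N=\emptyset$), regarded as a subspace of $(U^* )^N$, the space of all maps $N\to U^*$. $D_N(U):=(U^* )^N\smallsetminus \mathrm{Conf}_N(U)$ is the closed subset of maps $f:N\to U^*$ which have $*$ in their image or fail to be injective. The cells of $\mathrm{Conf}_N(U)$ are the relative cells of the pair $((U^* )^N,D_N(U))$. The $d$-skeleton of $U$ is the union of the cells of $U^*$ of dimension $\le d$ other than $\{*\}$; in particular the $1$-skeleton of $U$ is the union of its open $1$-cells. *)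

(* Defs.v *)
From mathcomp Require Import all_boot all_order all_algebra.
From mathcomp Require Import all_classical all_reals all_analysis.

Set Implicit Arguments.
Unset Strict Implicit.
Unset Printing Implicit Defensive.

Import Order.TTheory GRing.Theory Num.Theory.
Import numFieldNormedType.Exports.

Local Open Scope classical_set_scope.
Local Open Scope ring_scope.

(* Euclidean disks and spheres, written out because the library norm on
   'rV[R]_k is the sup norm. In dimension 0 the closed and the open disk are
   the one-point space and the sphere is empty. *)
Section disks.
Variables (R : realType) (k : nat).

Definition sqnorm (x : 'rV[R]_k) : R := \sum_(j < k) x ord0 j ^+ 2.
Definition disk : set 'rV[R]_k := [set x | sqnorm x <= 1].
Definition open_disk : set 'rV[R]_k := [set x | sqnorm x < 1].
Definition sphere : set 'rV[R]_k := [set x | sqnorm x = 1].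

End disks.
Arguments disk : clear implicits.
Arguments open_disk : clear implicits.
Arguments sphere : clear implicits.

(* A finite family of cells exhausting X outside the closed subset A, without
   any condition on the attaching maps. Characteristic maps are total
   functions on 'rV[R]_d of which only the restriction to the closed disk
   matters. Together with either condition on the attaching maps below, the
   weak topology condition makes each characteristic map a homeomorphism from
   the open disk onto the corresponding open cell. *)
Record cell_structure (R : realType) (X : topologicalType) (A : set X) :=
  CellStructure {
    ncells : nat;
    cdim : 'I_ncells -> nat;
    charmap : forall i, 'rV[R]_(cdim i) -> X;
    charmap_continuous :
      forall i, {within disk R (cdim i), continuous (@charmap i)};
    charmap_inj : forall i, set_inj (open_disk R (cdim i)) (@charmap i);
    cells_disjoint :
      trivIset setT (fun i => @charmap i @` open_disk R (cdim i));
    cells_cover :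
      \bigcup_i (@charmap i @` open_disk R (cdim i)) = ~` A;
    base_closed : closed A;
    weak_topology : forall C : set X,
      closed (A `&` C) ->
      (forall i, closed (disk R (cdim i) `&` (@charmap i @^-1` C))) ->
      closed C
  }.

Section cell_structure_theory.
Variables (R : realType) (X : topologicalType) (A : set X).
Variable s : cell_structure R A.

Definition cell (i : 'I_(ncells s)) : set X :=
  @charmap _ _ _ s i @` open_disk R (cdim i).

Definition cell_boundary (i : 'I_(ncells s)) : set X :=
  @charmap _ _ _ s i @` sphere R (cdim i).

(* (X, A) is a relative finite cell complex: X is obtained from A by attaching
   the cells 0, 1, ..., ncells s - 1 one after the other. As usual for cell
   complexes, and unlike for CW complexes, the dimensions need not increase
   along this order. *)
Definition is_cell_complex : Prop :=
  forall i, cell_boundary i `<=`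
    A `|` \bigcup_(j in [set j : 'I_(ncells s) | (j < i)%N]) cell j.

(* (X, A) is a relative finite CW complex: cells are attached to the union of
   A and the cells of lower dimension. *)
Definition is_CW_complex : Prop :=
  hausdorff_space X /\
  forall i, cell_boundary i `<=`
    A `|` \bigcup_(j in [set j : 'I_(ncells s) | (cdim j < cdim i)%N]) cell j.

Definition is_only_zero_cell (x : X) : Prop :=
  exists2 i : 'I_(ncells s), cell i = [set x] &
    forall j : 'I_(ncells s), cdim j = 0%N <-> j = i.

End cell_structure_theory.

(* The pair (X, A) is m-connected; every pair is (-1)-connected. *)
Definition connected_pair (R : realType) (m : int) (X : topologicalType)
    (A : set X) : Prop :=
  forall (k : nat) (g : 'rV[R]_k -> X), k%:Z <= m ->
    {within disk R k, continuous g} ->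
    g @` sphere R k `<=` A ->
    exists H : R * 'rV[R]_k -> X,
      [/\ {within `[0, 1]%classic `*` disk R k, continuous H},
          forall x, disk R k x -> H (0, x) = g x,
          forall x, disk R k x -> A (H (1, x)) &
          forall t x, 0 <= t <= 1 -> sphere R k x -> H (t, x) = g x].

Section configurations.
Variables (U : topologicalType) (N : finType).

Definition pt_power : topologicalType :=
  prod_topology (fun _ : N => one_point_compactification U).

(* Conf_N(S), for S a subspace of U, as a subset of (U^* )^N. *)
Definition Conf (S : set U) : set pt_power :=
  [set f | injective f /\ forall x : N, (Some @` S) (f x)].

Definition DN : set pt_power := ~` Conf setT.

End configurations.
Arguments DN : clear implicits.

Section skeleta.
Variables (R : realType) (U : topologicalType).
Variable s : cell_structure R (set0 : set (one_point_compactification U)).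

(* Subsets of U: taking preimages under Some discards the cell {*}. *)
Definition skeleton (d : nat) : set U :=
  Some @^-1` \bigcup_(i in [set i | (@cdim _ _ _ s i <= d)%N]) cell i.

Definition one_cells : set U :=
  Some @^-1` \bigcup_(i in [set i | @cdim _ _ _ s i = 1%N]) cell i.

End skeleta.

(* Main.v *)
Require Import Defs.
From mathcomp Require Import all_boot all_order all_algebra.
From mathcomp Require Import all_classical all_reals all_analysis.
From mathcomp Require Import lra.

Import Order.TTheory GRing.Theory Num.Theory.
Import numFieldNormedType.Exports.

Local Open Scope classical_set_scope.
Local Open Scope ring_scope.
Set Implicit Arguments.
Unset Strict Implicit.
Unset Printing Implicit Defensive.

(** A point of U is located by the open cell that contains it and by its
    coordinates in that cell, which is an open cube. Following Fox and
    Neuwirth, a configuration is sorted by its combinatorial type [typ]: the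
    cell of each point and, for points of the same cell, the place where their
    coordinate vectors first differ and the order of the two coordinates there.
    Points that agree in their coordinates 0, ..., c share the coordinate c,
    so a type has finitely many independent coordinates, and in these the
    configurations of the type form an open convex polytope, cut out by strict
    linear inequalities. The closed polytope is radially homeomorphic to
    a disk; it is the source of the characteristic map [config] of the cell.

    The polytope of a type has dimension at least n + d - 1 if some point lies
    in a cell of dimension d ([tdim_ge]), because the last coordinates of the n
    points are pairwise distinct parameters, and the d - 1 earlier coordinates
    of the given point are further ones. This gives all statements about
    dimensions; in particular the cells of dimension n are those whose points
    all lie in 1-cells. These cells are connected, disjoint and closed in
    their union, so they are its connected components
    ([one_cells_component]).

    On the boundary of the polytope, either some point falls into the boundary
    of its cell, hence to the added point or into a cell of lower dimension, or
    all points stay in their cells and two of the parameters become equal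
    ([config_boundary]). So the cells can be attached in the order of the sum
    of the dimensions of the cells of the points, and then of the dimension of
    the polytope. The first kind of degeneration may increase the dimension of
    the polytope, so the result need not be a CW complex.

    The connectivity follows from the dimensions for every relative finite cell
    complex ([connected_pair_cell_complex]). A map from a disk to the stage of
    the complex ending with a cell of larger dimension can be changed inside
    that cell so as to miss its centre: approximate its coordinates by a
    Lipschitz map, which does not fill the cell ([nonvanishing_approx]). What
    misses the centre can be pushed radially to the boundary of the cell. This
    is repeated for the cells in the reverse order of attachment. *)

(** * Continuity on closed and compact subsets *)

Section subsets.
Variables T Y Z : topologicalType.

Lemma within_closedP (A : set T) (f : T -> Y) : closed A ->
  {within A, continuous f} <->
  forall C, closed C -> closed (A `&` f @^-1` C).
Proof.
move=> cA; split.
  by move=> /continuous_closedP fc C /fc; rewrite -closed_setSI.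
move=> fc; apply/continuous_closedP => C /fc.
by rewrite (closed_setSI _ cA).
Qed.

Lemma within_comp (A : set T) (B : set Y) (f : T -> Y) (g : Y -> Z) :
  f @` A `<=` B -> {within A, continuous f} -> {within B, continuous g} ->
  {within A, continuous (g \o f)}.
Proof.
move=> fAB /subspace_continuousP fc /subspace_continuousP gc.
apply/subspace_continuousP => x Ax.
apply: (cvg_comp _ _ _ (gc (f x) _)); last by apply: fAB; exists x.
move=> V /= VB; have := fc x Ax _ VB.
rewrite !nbhs_simpl /within /= => H.
have H' : \forall y \near nbhs x, A y -> B (f y) -> V (f y) by exact: H.
near=> y => Ay; apply: (near H' y) => //; apply: fAB; by exists y.
Unshelve. all: by end_near. Qed.

Lemma within_eq (A : set T) (f g : T -> Y) : (forall x, A x -> f x = g x) ->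
  {within A, continuous f} -> {within A, continuous g}.
Proof. by move=> fg; apply: subspace_eq_continuous => x /set_mem; exact: fg. Qed.

Lemma within_pair (A : set T) (f : T -> Y) (g : T -> Z) :
  {within A, continuous f} -> {within A, continuous g} ->
  {within A, continuous (fun x => (f x, g x))}.
Proof. by move=> fc gc x; apply: cvg_pair; [exact: fc|exact: gc]. Qed.

Lemma continuous_pair (f : T -> Y) (g : T -> Z) :
  continuous f -> continuous g -> continuous (fun x => (f x, g x)).
Proof. by move=> fc gc x; apply: cvg_pair; [exact: fc|exact: gc]. Qed.

Lemma compact_within_preimage (K : set T) (f : T -> Y) (C : set Y) :
  compact K -> {within K, continuous f} -> closed C ->
  compact (K `&` f @^-1` C).
Proof.
move=> cK /continuous_closedP fc /fc /closed_subspaceP[V cV VK].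
by rewrite setIC -VK setIC; exact: compact_closedI.
Qed.

End subsets.

Section subsets_quotient.
Variables T Y Z : topologicalType.

(** A continuous image of a compact set in a Hausdorff space carries the
    quotient topology, because the map is closed. *)
Lemma within_quotient (K : set T) (q : T -> Y) (F : Y -> Z) :
  hausdorff_space Y -> compact K -> {within K, continuous q} ->
  {within K, continuous (F \o q)} -> {within q @` K, continuous F}.
Proof.
move=> hY cK qc Fqc.
have cqK : closed (q @` K) by apply: compact_closed => //; exact: continuous_compact.
apply/(within_closedP F cqK) => C cC.
have -> : q @` K `&` F @^-1` C = q @` (K `&` (F \o q) @^-1` C).
  rewrite eqEsubset; split => [_ [[x Kx <-] Cx]|_ [x [Kx Cx] <-]]; first by exists x.
  by split => //; exists x.
apply: compact_closed => //; apply: continuous_compact.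
  by apply: continuous_subspaceW qc => x [].
exact: compact_within_preimage.
Qed.

Lemma within_paste (A B : set T) (f g h : T -> Y) : closed A -> closed B ->
  {within A, continuous f} -> {within B, continuous g} ->
  (forall x, A x -> f x = h x) -> (forall x, B x -> g x = h x) ->
  {within A `|` B, continuous h}.
Proof.
move=> cA cB fc gc fh gh.
by apply: withinU_continuous => //; [exact: within_eq fc|exact: within_eq gc].
Qed.

End subsets_quotient.

Lemma within_prod_topology (T Y : topologicalType) (I : eqType) (A : set T)
    (f : T -> prod_topology (fun _ : I => Y)) :
  (forall i, {within A, continuous (fun x => f x i)}) ->
  {within A, continuous f}.
Proof.
move=> fc x; apply/cvg_sup => i.
have /= H := fc i x.
move=> /= V [W [[B oB <-] /= Bfx] WV].
have := H B; rewrite nbhsE /= => H2.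
have : nbhs (f x i) B by apply: open_nbhs_nbhs.
move=> /H; rewrite !nbhs_simpl /=; apply: filterS => y By; exact: WV.
Qed.

(** * Row vectors *)

Section row_vectors.
Variable R : realType.

Lemma rV_norm_lt n (v : 'rV[R]_n) e : 0 < e ->
  `|v| < e <-> forall j, `|v ord0 j| < e.
Proof.
move=> e0; rewrite [`|v|]/Num.norm /= mx_normrE; split.
  by move=> /bigmax_ltP[_ H] j; exact: (H (ord0, j)).
by move=> H; apply/bigmax_ltP; split => // -[i j] _ /=; rewrite ord1.
Qed.

Lemma rV_norm_le n (v : 'rV[R]_n) e : 0 <= e ->
  `|v| <= e <-> forall j, `|v ord0 j| <= e.
Proof.
move=> e0; rewrite [`|v|]/Num.norm /= mx_normrE; split.
  by move=> /bigmax_leP[_ H] j; exact: (H (ord0, j)).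
by move=> H; apply/bigmax_leP; split => // -[i j] _ /=; rewrite ord1.
Qed.

Lemma rV_norm_coord n (v : 'rV[R]_n) j : `|v ord0 j| <= `|v|.
Proof. by apply: (rV_norm_le v (normr_ge0 v)).1. Qed.

Lemma rV_cvg (T : Type) (F : set_system T) (FF : Filter F) n
    (f : T -> 'rV[R]_n) (v : 'rV[R]_n) :
  (forall j, (fun x => f x ord0 j) @ F --> v ord0 j) -> f @ F --> v.
Proof.
move=> fc; apply/cvgrPdist_lt => e e0.
have H j : \forall x \near F, `|v ord0 j - f x ord0 j| < e.
  by move/cvgrPdist_lt: (fc j); exact.
move: (filter_forall FF H); apply: (@filterS _ F FF) => x Hx.
by apply/rV_norm_lt => // j; rewrite !mxE.
Qed.

Lemma within_rV (T : topologicalType) (A : set T) n (f : T -> 'rV[R]_n) :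
  (forall j, {within A, continuous (fun x => f x ord0 j)}) ->
  {within A, continuous f}.
Proof. by move=> fc x; apply: rV_cvg => j; exact: fc. Qed.

End row_vectors.

(** * Gauges *)

Section gauges.
Variable R : realType.

(** The last condition makes the sublevel sets compact. *)
Definition gauge n (q : 'rV[R]_n -> R) :=
  [/\ continuous q, forall a v, 0 <= a -> q (a *: v) = a * q v &
      exists2 c, 0 < c & forall v, c * `|v| <= q v].

Section theory.
Variables (n : nat) (q : 'rV[R]_n -> R).
Hypothesis gq : gauge q.

Lemma gauge_scale a v : 0 <= a -> q (a *: v) = a * q v.
Proof. by case: gq => _ + _; exact. Qed.

Lemma gauge0 : q 0 = 0.
Proof. by rewrite -(scale0r 0) gauge_scale // mul0r. Qed.

Lemma gauge_ge0 v : 0 <= q v.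
Proof.
by case: gq => _ _ [c c0 /(_ v)]; apply: le_trans; rewrite mulr_ge0 // ltW.
Qed.

Lemma gauge_eq0 v : q v = 0 -> v = 0.
Proof.
case: gq => _ _ [c c0 /(_ v)] + qv0; rewrite qv0 pmulr_rle0 // => H.
by apply/eqP; rewrite -normr_le0.
Qed.

Lemma gauge_gt0 v : v != 0 -> 0 < q v.
Proof.
move=> v0; rewrite lt_neqAle gauge_ge0 andbT eq_sym.
by apply: contra_neq v0 => /gauge_eq0.
Qed.

Lemma gauge_continuous : continuous q. Proof. by case: gq. Qed.

Lemma gauge_compact r : compact [set v | q v <= r].
Proof.
case: gq => qc _ [c c0 qb]; apply: bounded_closed_compact.
  exists (r / c); split; first exact: num_real.
  move=> M rM v /= qvr; apply: le_trans (ltW rM).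
  by rewrite ler_pdivlMr // mulrC (le_trans (qb v)).
by apply: (@preimage_closed _ _ q [set x | x <= r]) => //; exact: closed_le.
Qed.

End theory.

Lemma gauge_norm n : gauge (fun v : 'rV[R]_n => `|v|).
Proof.
split; first exact: norm_continuous.
  by move=> a v a0; rewrite normrZ ger0_norm.
by exists 1 => // v; rewrite mul1r.
Qed.

(** Rescaling each ray turns the unit ball of q1 into the unit ball of q2. *)
Definition radial n (q1 q2 : 'rV[R]_n -> R) (v : 'rV[R]_n) : 'rV[R]_n :=
  (q1 v / q2 v) *: v.

Section radial_theory.
Variables (n : nat) (q1 q2 : 'rV[R]_n -> R).
Hypotheses (g1 : gauge q1) (g2 : gauge q2).

Lemma radial_gauge v : q2 (radial q1 q2 v) = q1 v.
Proof.
rewrite (gauge_scale g2); last by rewrite divr_ge0 // gauge_ge0.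
have [->|v0] := eqVneq v 0; first by rewrite !gauge0 // mulr0.
by rewrite divfK // gt_eqF // gauge_gt0.
Qed.

Lemma radialK : cancel (radial q1 q2) (radial q2 q1).
Proof.
move=> v; rewrite {1}/radial radial_gauge {1}/radial (gauge_scale g1); last first.
  by rewrite divr_ge0 // gauge_ge0.
have [->|v0] := eqVneq v 0; first by rewrite /radial !scaler0.
have q1v : q1 v != 0 by rewrite gt_eqF // gauge_gt0.
have q2v : q2 v != 0 by rewrite gt_eqF // gauge_gt0.
rewrite scalerA -[RHS]scale1r; congr (_ *: _).
set x := _ / q2 v; have x0 : x != 0 by rewrite mulf_neq0 // invr_eq0.
move: x x0 => x x0; by rewrite invfM [x^-1 * _]mulrC mulrA divff // mul1r mulVf.
Qed.

Lemma radial_continuous : continuous (radial q1 q2).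
Proof.
move=> v; have [->|v0] := eqVneq v 0; last first.
  apply: (@continuousZ _ _ _ (fun w => q1 w / q2 w) id); last exact: cvg_id.
  apply: (@continuousM _ _ q1 (fun w => (q2 w)^-1)); first exact: (gauge_continuous g1).
  by apply: continuousV; [rewrite gt_eqF // gauge_gt0|exact: (gauge_continuous g2)].
have r0 : radial q1 q2 0 = 0 by rewrite /radial scaler0.
rewrite /continuous_at r0; have [_ _ [c c0 qb]] := g2.
apply/(@cvgr0Pnorm_le _ _ _ (nbhs (0 : 'rV[R]_n)) _ _) => e e0.
have : \forall w \near (0 : 'rV[R]_n), `|0 - q1 w| < c * e.
  have q1c : continuous q1 by exact: gauge_continuous.
  have /(@cvgrPdist_lt _ _ _ (nbhs (0 : 'rV[R]_n)) _ _) := q1c 0.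
  by rewrite (gauge0 g1); apply; rewrite mulr_gt0.
apply: filterS => w; rewrite sub0r normrN => H.
rewrite -(ler_pM2l c0); apply: (le_trans (qb _)); rewrite radial_gauge.
by apply: le_trans (ltW H); exact: ler_norm.
Qed.

End radial_theory.

Definition enorm n (v : 'rV[R]_n) : R := Num.sqrt (sqnorm v).

Lemma sqnorm_ge0 n (v : 'rV[R]_n) : 0 <= sqnorm v.
Proof. by apply: sumr_ge0 => j _; exact: sqr_ge0. Qed.

Lemma gauge_enorm n : gauge (@enorm n).
Proof.
split.
- have sc : continuous (@sqnorm R n).
    apply: (@continuous_big _ _ _ _ _ add_continuous) => j _ v.
    by apply: (@continuousM _ _ (fun w : 'rV[R]_n => w ord0 j)) => //;
      exact: coord_continuous.
  move=> v; apply: (@continuous_comp _ _ _ (@sqnorm R n) Num.sqrt).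
    exact: sc.
  exact: sqrt_continuous.
- move=> a v a0; rewrite /enorm; have -> : sqnorm (a *: v) = a ^+ 2 * sqnorm v.
    by rewrite /sqnorm mulr_sumr; apply: eq_bigr => j _; rewrite mxE exprMn.
  by rewrite sqrtrM ?sqr_ge0 // sqrtr_sqr ger0_norm.
- exists 1 => // v; rewrite mul1r; apply/rV_norm_le; first exact: sqrtr_ge0.
  move=> j; rewrite -sqrtr_sqr; apply: ler_wsqrtr.
  by rewrite /sqnorm (bigD1 j) //= lerDl; apply: sumr_ge0 => i _; exact: sqr_ge0.
Qed.

Lemma disk_enorm n (v : 'rV[R]_n) : disk R n v <-> enorm v <= 1.
Proof. by rewrite /disk /= /enorm -(@ler_sqrt _ _ 1) // sqrtr1. Qed.

Lemma open_disk_enorm n (v : 'rV[R]_n) : open_disk R n v <-> enorm v < 1.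
Proof. by rewrite /open_disk /= /enorm -(@ltr_sqrt _ _ 1) // sqrtr1. Qed.

Lemma sphere_enorm n (v : 'rV[R]_n) : sphere R n v <-> enorm v = 1.
Proof.
rewrite /sphere /= /enorm; split => [->|/(congr1 (fun x => x ^+ 2))].
  by rewrite sqrtr1.
by rewrite sqr_sqrtr ?sqnorm_ge0 // expr1n.
Qed.

Lemma disk_compact n : compact (disk R n).
Proof.
have -> : disk R n = [set v | enorm v <= 1].
  by apply/seteqP; split => v /disk_enorm.
exact/gauge_compact/gauge_enorm.
Qed.

End gauges.

(** * Maps into a space of larger dimension *)

Section approximation.
Variable R : realType.

(** The infimum of the cones u y + l * `|x - y| over y in K is l-Lipschitz,
    and close to u once l is large enough to make the cones over distant
    points irrelevant. *)
Lemma lipschitz_approx k (K : set 'rV[R]_k) (u : 'rV[R]_k -> R) (e : R) :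
  compact K -> {within K, continuous u} -> 0 < e ->
  exists (L : 'rV[R]_k -> R) (l : R), 0 <= l /\
    (forall x y, `|L x - L y| <= l * `|x - y|) /\
    forall x, K x -> `|L x - u x| <= e.
Proof.
move=> cK uc e0.
have [K0|/set0P Kn] := eqVneq K set0.
  exists (fun=> 0), 0; split => //; split => [x y|x]; last by rewrite K0.
  by rewrite subrr normr0 mul0r.
have [M M0 uM] : exists2 M, 0 < M & forall x, K x -> `|u x| <= M.
  have /ex_strict_bound_gt0[M M0 HM] : bounded_set (u @` K).
    exact/compact_bounded/continuous_compact.
  by exists M => // x Kx; apply/ltW/HM; exists x.
have [l l0 Hl] : exists2 l, 0 <= l &
    forall x y, K x -> K y -> u x - e <= u y + l * `|x - y|.
  have vc : {within K `*` K, continuous (fun p => u p.1 - u p.2)}.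
    have u1 : {within K `*` K, continuous (fun p => u p.1)}.
      apply: (@within_comp _ _ _ (K `*` K) K fst u) => //.
        by move=> _ [p [K1 K2] <-].
      by apply: continuous_subspaceT => p; exact: cvg_fst.
    have u2 : {within K `*` K, continuous (fun p => u p.2)}.
      apply: (@within_comp _ _ _ (K `*` K) K snd u) => //.
        by move=> _ [p [K1 K2] <-].
      by apply: continuous_subspaceT => p; exact: cvg_snd.
    by move=> p; apply: cvgB; [exact: u1|exact: u2].
  pose P := (K `*` K) `&` (fun p => u p.1 - u p.2) @^-1` [set t | e <= t].
  have cP : compact P.
    by apply: compact_within_preimage vc _; [exact: compact_setX|exact: closed_ge].
  have [P0|/set0P Pn] := eqVneq P set0.
    exists 0 => // x y Kx Ky; rewrite mul0r addr0 lerBlDl.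
    rewrite leNgt; apply/negP => H.
    by have : P (x, y) by [split => //=; lra]; rewrite P0.
  have [|q /set_mem [[Kq1 Kq2] /= qe] qmin] :=
      @compact_EVT_min _ R (fun p : 'rV[R]_k * 'rV[R]_k => `|p.1 - p.2|) P Pn cP.
    apply: continuous_subspaceT => p.
    apply: (@continuous_comp _ _ _ (fun p : 'rV[R]_k * 'rV[R]_k => p.1 - p.2)
      (fun v => `|v|)); last exact: norm_continuous.
    by apply: (@continuousB _ _ _ fst snd); [exact: cvg_fst|exact: cvg_snd].
  have d0 : 0 < `|q.1 - q.2|.
    rewrite normr_gt0 subr_eq0; apply/eqP => q12.
    by move: qe; rewrite q12 subrr leNgt e0.
  exists (2 * M / `|q.1 - q.2|).
    by rewrite divr_ge0 // mulr_ge0 // ltW.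
  move=> x y Kx Ky; have [H|H] := leP e (u x - u y); last first.
    have : 0 <= 2 * M / `|q.1 - q.2| * `|x - y|.
      by rewrite mulr_ge0 // divr_ge0 // mulr_ge0 // ltW.
    lra.
  have /= : `|q.1 - q.2| <= `|x - y| by apply: (qmin (x, y)); apply/mem_set.
  have ux := uM _ Kx; have uy := uM _ Ky.
  move: ux uy; rewrite !ler_norml => /andP[_ ux] /andP[uy _] qxy.
  have : 2 * M <= 2 * M / `|q.1 - q.2| * `|x - y|.
    by rewrite -mulrA ler_peMr ?mulr_ge0 // ?(ltW M0) // mulrC ler_pdivlMr // mul1r.
  lra.
pose S x := [set u y + l * `|x - y| | y in K].
have Sn x : S x !=set0 by case: Kn => y Ky; exists (u y + l * `|x - y|), y.
have Slb x : has_lbound (S x).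
  exists (- M) => _ [y Ky <-]; have := uM _ Ky.
  rewrite ler_norml => /andP[H _].
  by rewrite (le_trans H) // lerDl mulr_ge0.
have LL x y : inf (S x) <= inf (S y) + l * `|x - y|.
  rewrite -lerBlDr; apply: lb_le_inf => // _ [z Kz <-].
  rewrite lerBlDr; apply: (@le_trans _ _ (u z + l * `|x - z|)).
    by apply: ge_inf => //; exists z.
  rewrite -addrA lerD2l -mulrDr ler_wpM2l // [leRHS]addrC.
  exact: ler_distD.
exists (fun x => inf (S x)), l; split => //; split => [x y|x Kx].
  rewrite ler_norml; have := LL x y; have := LL y x; rewrite (distrC y) => ? ?.
  by apply/andP; split; lra.
rewrite ler_norml; apply/andP; split.
  rewrite lerBrDl; apply: lb_le_inf => // _ [y Ky <-]; exact: Hl.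
rewrite lerBlDl (le_trans (_ : _ <= u x)) //; last by rewrite lerDl ltW.
apply: ge_inf => //; exists x => //.
by rewrite subrr normr0 mulr0 addr0.
Qed.

Lemma lipschitz_approx_rV k m (K : set 'rV[R]_k) (u : 'rV[R]_k -> 'rV[R]_m)
    (e : R) :
  compact K -> {within K, continuous u} -> 0 < e ->
  exists (L : 'rV[R]_k -> 'rV[R]_m) (l : R), 0 <= l /\
    (forall x y, `|L x - L y| <= l * `|x - y|) /\
    forall x, K x -> `|L x - u x| <= e.
Proof.
move=> cK uc e0.
have /boolp.choice[L HL] : forall j : 'I_m, exists Lj : ('rV[R]_k -> R) * R,
    [/\ 0 <= Lj.2, forall x y, `|Lj.1 x - Lj.1 y| <= Lj.2 * `|x - y| &
    forall x, K x -> `|Lj.1 x - u x ord0 j| <= e].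
  move=> j; have [] := @lipschitz_approx _ K (fun x => u x ord0 j) e cK _ e0.
    apply: (@within_comp _ _ _ K setT u (fun v : 'rV[R]_m => v ord0 j)) => //.
    by apply: continuous_subspaceT; exact: coord_continuous.
  by move=> L [l [? [? ?]]]; exists (L, l).
have l0 : 0 <= \sum_j (L j).2 by apply: sumr_ge0 => j _; case: (HL j).
exists (fun x => \row_j (L j).1 x), (\sum_j (L j).2); split => //; split.
  move=> x y; apply/rV_norm_le; first by rewrite mulr_ge0.
  move=> j; rewrite !mxE; case: (HL j) => _ Lj _; apply: (le_trans (Lj x y)).
  rewrite ler_wpM2r // (bigD1 j) //= lerDl.
  by apply: sumr_ge0 => i _; case: (HL i).
move=> x Kx; apply/rV_norm_le; first exact: ltW.
by move=> j; rewrite !mxE; case: (HL j) => _ _; exact.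
Qed.

(** A Lipschitz map does not raise dimension. Cut K into N ^ k boxes of side
    proportional to 1 / N. If all T ^ m points of a grid of mesh e / T were
    attained, then by counting two of them would be attained in the same box,
    which is too small for that. With N = c * T and T = c ^ k + 1, the
    inequality N ^ k < T ^ m needed for the counting follows from k < m. *)
Lemma lipschitz_misses k m (K : set 'rV[R]_k) (L : 'rV[R]_k -> 'rV[R]_m)
    (l e : R) :
  (k < m)%N -> bounded_set K -> 0 <= l -> 0 < e ->
  (forall x y, `|L x - L y| <= l * `|x - y|) ->
  exists2 p, `|p| <= e & forall x, K x -> L x != p.
Proof.
move=> km /ex_strict_bound_gt0[b b0 Kb] l0 e0 Llip.
apply: contrapT => H.
have {}H p : `|p| <= e -> exists2 x, K x & L x = p.
  move=> pe; apply: contrapT => Hp; apply: H; exists p => // x Kx.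
  by apply/eqP => Lx; apply: Hp; exists x.
pose c := (Num.truncn (2 * b * l / e)).+1.
have c_gt : 2 * b * l / e < c%:R.
  by apply: truncnS_gt.
pose T := (c ^ k).+1; pose N := (c * T)%N.
have T0 : 0 < T%:R :> R by rewrite ltr0n.
have N0 : (0 < N)%N by rewrite muln_gt0.
have N0R : 0 < N%:R :> R by rewrite ltr0n.
pose p (t : {ffun 'I_m -> 'I_T}) : 'rV[R]_m := \row_j (e / T%:R * (t j)%:R).
have /boolp.choice[z Hz] t : exists x, K x /\ L x = p t.
  have [|x Kx Lx] := H (p t); last by exists x.
  apply/rV_norm_le; first exact: ltW.
  move=> j; rewrite mxE ger0_norm; last by rewrite mulr_ge0 // divr_ge0 // ltW.
  by rewrite mulrAC ler_pdivrMr // ler_pM2l // ler_nat ltnW.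
pose a t j : R := (z t ord0 j + b) / (2 * b) * N%:R.
have zb t j : `|z t ord0 j| < b.
  by apply: le_lt_trans (Kb _ (Hz t).1); exact: rV_norm_coord.
have b20 : 0 < 2 * b by rewrite mulr_gt0.
have a0 t j : 0 <= a t j.
  rewrite mulr_ge0 ?divr_ge0 ?(ltW b20) //.
  by have := zb t j; rewrite ltr_norml => /andP[? _]; lra.
have aN t j : (Num.truncn (a t j) < N)%N.
  rewrite -(ltr_nat R); apply: (@le_lt_trans _ _ (a t j)).
    by have /andP[] := truncn_itv (a0 t j).
  rewrite gtr_pMl // ltr_pdivrMr // mul1r.
  by have := zb t j; rewrite ltr_norml => /andP[_ ?]; lra.
pose box t : {ffun 'I_k -> 'I_N} := [ffun j => Ordinal (aN t j)].
have /injectivePn[t [t' tt' boxE]] : ~~ injectiveb box.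
  apply/negP => /injectiveP /leq_card; apply/negP; rewrite -ltnNge.
  rewrite !card_ffun !card_ord expnMn.
  apply: (@leq_trans (T * T ^ k)); first by rewrite ltn_pmul2r // expn_gt0.
  by rewrite -expnS leq_pexp2l.
have {}boxE j : `|a t j - a t' j| < 1.
  have /ffunP/(_ j)/(congr1 val) := boxE; rewrite !ffunE /= => E.
  have /andP[H1 H2] := truncn_itv (a0 t j).
  have /andP[] := truncn_itv (a0 t' j); rewrite -E => H3 H4.
  move: H2 H4; rewrite -!natr1 ltr_norml => H2 H4.
  by apply/andP; split; lra.
have zz : `|z t - z t'| <= 2 * b / N%:R.
  apply/rV_norm_le; first by rewrite divr_ge0 // ltW.
  move=> j; rewrite !mxE ler_pdivlMr // -[leRHS]mulr1 -ler_pdivrMl //.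
  have -> : (2 * b)^-1 * (`|z t ord0 j - z t' ord0 j| * N%:R) =
      `|a t j - a t' j|.
    rewrite /a -!mulrBl opprD addrACA subrr addr0 !normrM.
    rewrite (gtr0_norm N0R) (gtr0_norm (_ : 0 < (2 * b)^-1)) ?invr_gt0 //.
    by rewrite mulrCA mulrA.
  exact/ltW.
have pp : e / T%:R <= `|p t - p t'|.
  have [j tj] : exists j, t j != t' j.
    apply: contrapT => tE; case/eqP: tt'; apply/ffunP => j.
    by apply/eqP; apply: contrapT => /negP tj; apply: tE; exists j.
  apply: le_trans (rV_norm_coord _ j); rewrite !mxE -mulrBr normrM.
  rewrite gtr0_norm ?divr_gt0 // ler_pMr ?divr_gt0 // ler_normr.
  move: tj; rewrite -val_eqE neq_ltn => /orP[].
    by rewrite -(ler_nat R) -natr1 => tt; apply/orP; right; lra.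
  by rewrite -(ler_nat R) -natr1 => tt; apply/orP; left; lra.
have : e / T%:R <= l * (2 * b / N%:R).
  apply: (le_trans pp); rewrite -(Hz t).2 -(Hz t').2.
  by apply: (le_trans (Llip _ _)); rewrite ler_wpM2l.
rewrite ler_pdivrMr // /N natrM invfM.
have -> : l * (2 * b * (c%:R^-1 * T%:R^-1)) * T%:R = 2 * b * l / c%:R.
  rewrite -!mulrA [_^-1 * T%:R]mulVf ?gt_eqF // mulr1.
  by rewrite mulrC -!mulrA [c%:R^-1 * _]mulrC.
rewrite ler_pdivlMr ?ltr0n // mulrC -ler_pdivlMr // leNgt.
by rewrite c_gt.
Qed.

Lemma nonvanishing_approx k m (K : set 'rV[R]_k) (u : 'rV[R]_k -> 'rV[R]_m)
    (e : R) :
  (k < m)%N -> compact K -> {within K, continuous u} -> 0 < e ->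
  exists u' : 'rV[R]_k -> 'rV[R]_m, continuous u' /\
    forall x, K x -> `|u' x - u x| < e /\ u' x != 0.
Proof.
move=> km cK uc e0.
have e3 : 0 < e / 3 by lra.
have [L [l [l0 [Llip Lu]]]] := lipschitz_approx_rV cK uc e3.
have [p pe Lp] := lipschitz_misses km (compact_bounded cK) l0 e3 Llip.
have Lc : continuous L.
  move=> x; apply/(@cvgrPdist_lt _ _ _ (nbhs x)) => d d0.
  have l1 : 0 < l + 1 by lra.
  have : \forall y \near x, `|x - y| < d / (l + 1).
    by apply: (@cvgr_dist_lt _ _ _ (nbhs x)) => //; rewrite divr_gt0.
  apply: filterS => y xy; apply: le_lt_trans (Llip _ _) _.
  apply: (@le_lt_trans _ _ ((l + 1) * `|x - y|)); first by rewrite ler_wpM2r //; lra.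
  by rewrite mulrC -ltr_pdivlMr.
exists (fun x => L x - p); split.
  move=> x; apply: (@continuousB _ _ _ L (fun=> p)); first exact: Lc.
  exact: cst_continuous.
move=> x Kx; split; last by rewrite subr_eq0 Lp.
rewrite addrAC; apply: (le_lt_trans (ler_normB _ _)).
by have := Lu x Kx; lra.
Qed.

End approximation.

(** * Homotopies relative to the sphere *)

Lemma hausdorff_prod (T Y : topologicalType) :
  hausdorff_space T -> hausdorff_space Y -> hausdorff_space (T * Y)%type.
Proof.
move=> hT hY [p1 p2] [q1 q2] pq; congr (_, _).
  apply: hT => A B Ap Bq.
  have [||x [[/= ? _] [/= ? _]]] := pq (A `*` setT) (B `*` setT); last by exists x.1.
    by exists (A, setT) => //=; split => //; exact: filterT.
  by exists (B, setT) => //=; split => //; exact: filterT.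
apply: hY => A B Ap Bq.
have [||x [[/= _ ?] [/= _ ?]]] := pq (setT `*` A) (setT `*` B); last by exists x.2.
  by exists (setT, A) => //=; split => //; exact: filterT.
by exists (setT, B) => //=; split => //; exact: filterT.
Qed.

Section homotopy.
Variables (R : realType) (X : topologicalType) (k : nat).
Implicit Types g : 'rV[R]_k -> X.

Definition homotopic_rel g g' := exists H : R * 'rV[R]_k -> X,
  [/\ {within `[0, 1]%classic `*` disk R k, continuous H},
      forall x, disk R k x -> H (0, x) = g x,
      forall x, disk R k x -> H (1, x) = g' x &
      forall t x, 0 <= t <= 1 -> sphere R k x -> H (t, x) = g x].

Lemma sphere_disk : sphere R k `<=` disk R k.
Proof. by move=> x /sphere_enorm xE; apply/disk_enorm; rewrite xE. Qed.

Lemma homotopic_rel_refl g : {within disk R k, continuous g} ->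
  homotopic_rel g g.
Proof.
move=> gc; exists (g \o snd); split => //.
apply: (@within_comp _ _ _ _ (disk R k)) => //; first by move=> _ [x [_ ?] <-].
by apply: continuous_subspaceT => p; exact: cvg_snd.
Qed.

Lemma homotopic_rel_trans g1 g2 g3 :
  homotopic_rel g1 g2 -> homotopic_rel g2 g3 -> homotopic_rel g1 g3.
Proof.
move=> [H [Hc H0 H1 Hs]] [G [Gc G0 G1 Gs]].
pose F (p : R * 'rV[R]_k) :=
  if p.1 <= 1 / 2 then H (2 * p.1, p.2) else G (2 * p.1 - 1, p.2).
have cI (a b : R) : closed (`[a, b]%classic `*` disk R k).
  apply: compact_closed.
    by apply: hausdorff_prod; [exact: Rhausdorff|exact: norm_hausdorff].
  by apply: compact_setX; [exact: segment_compact|exact: disk_compact].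
have c2 : continuous (fun p : R * 'rV[R]_k => 2 * p.1).
  by move=> p; apply: cvgMl_tmp; exact: cvg_fst.
have s2 : continuous (snd : R * 'rV[R]_k -> _) by move=> p; exact: cvg_snd.
have DE : (`[0, 1]%classic : set R) `*` disk R k =
    `[0, 1 / 2]%classic `*` disk R k `|` `[1 / 2, 1]%classic `*` disk R k.
  rewrite eqEsubset; split => -[t x] /=; rewrite !in_itv /=.
    move=> [t01 Dx]; have [t2|t2] := leP t (1 / 2); [left|right]; (split => //); lra.
  by move=> [] [t01 Dx]; (split => //); lra.
exists F; split.
- rewrite DE.
  pose H' (p : R * 'rV[R]_k) := H (2 * p.1, p.2).
  pose G' (p : R * 'rV[R]_k) := G (2 * p.1 - 1, p.2).
  apply: (within_paste (cI 0 (1 / 2)) (cI (1 / 2) 1) (f := H') (g := G')).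
  + apply: (within_comp (f := fun p : R * 'rV[R]_k => (2 * p.1, p.2)) _ _ Hc).
      move=> _ [[t x] /= [t01 Dx] <-]; move: t01; rewrite /= !in_itv /= => t01.
      by (split => //); lra.
    by apply: continuous_subspaceT; exact: continuous_pair.
  + apply: (within_comp (f := fun p : R * 'rV[R]_k => (2 * p.1 - 1, p.2)) _ _ Gc).
      move=> _ [[t x] /= [t01 Dx] <-]; move: t01; rewrite /= !in_itv /= => t01.
      by (split => //); lra.
    apply: continuous_subspaceT; apply: continuous_pair => // p.
    apply: (@continuousB _ _ _ (fun p : R * 'rV[R]_k => 2 * p.1) (fun=> 1)).
      exact: c2.
    exact: cst_continuous.
  + by move=> [t x] [/= + Dx]; rewrite in_itv /F /= => /andP[_ ->].
  + move=> [t x] [/= + Dx]; rewrite in_itv /F /G' /= => /andP[t2 _].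
    case: ifPn => // t2'; have -> : t = 1 / 2 by lra.
    have -> : 2 * (1 / 2) = 1 :> R by lra.
    by rewrite subrr G0 // H1.
- by move=> x Dx; rewrite /F /= mulr0 ifT ?H0 //; lra.
- move=> x Dx; rewrite /F /= ifF; last by apply: negbTE; rewrite -ltNge; lra.
  by rewrite (_ : 2 * 1 - 1 = 1) ?G1 //; lra.
- move=> t x t01 Sx; rewrite /F /=; case: ifPn => t2.
    by apply: Hs => //; lra.
  rewrite Gs //; last by lra.
  by rewrite -(H1 _ (sphere_disk Sx)) Hs //; lra.
Qed.

End homotopy.

(** * Cells parametrized by cubes *)

Section cubes.
Variables (R : realType) (X : topologicalType) (A : set X).
Variable s : cell_structure R A.
Implicit Types i j : 'I_(ncells s).

(** The radial homeomorphism from the cube to the disk lets the sup norm, the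
    norm of the ambient vector space, replace the Euclidean norm. *)
Definition cubemap i (v : 'rV[R]_(cdim i)) : X :=
  charmap (radial (fun v => `|v|) (@enorm R _) v).

Let enorm_radial i (v : 'rV[R]_(cdim i)) :
  enorm (radial (fun v => `|v|) (@enorm R _) v) = `|v|.
Proof. by rewrite (radial_gauge (gauge_norm R _) (gauge_enorm R _)). Qed.

Lemma cubemap_continuous i :
  {within [set v | `|v| <= 1], continuous (@cubemap i)}.
Proof.
apply: (within_comp (f := radial (fun v => `|v|) (@enorm R _)) _ _
  (@charmap_continuous _ _ _ s i)).
  by move=> _ [v /= v1 <-]; apply/disk_enorm; rewrite enorm_radial.
by apply: continuous_subspaceT; exact/radial_continuous/gauge_enorm/gauge_norm.
Qed.

Lemma cubemap_inj i (v w : 'rV[R]_(cdim i)) : `|v| < 1 -> `|w| < 1 ->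
  cubemap v = cubemap w -> v = w.
Proof.
move=> v1 w1 /(@charmap_inj _ _ _ s i _ _) E.
apply: (can_inj (radialK (gauge_norm R _) (gauge_enorm R _))).
by apply: E; apply/mem_set/open_disk_enorm; rewrite enorm_radial.
Qed.

Lemma cellP i y : cell i y <-> exists2 v, `|v| < 1 & @cubemap i v = y.
Proof.
split=> [[v /open_disk_enorm v1 <-]|[v v1 <-]]; last first.
  exists (radial (fun v => `|v|) (@enorm R _) v) => //.
  by apply/open_disk_enorm; rewrite enorm_radial.
exists (radial (@enorm R _) (fun v => `|v|) v).
  by rewrite (radial_gauge (gauge_enorm R _) (gauge_norm R _)).
by rewrite /cubemap (radialK (gauge_enorm R _) (gauge_norm R _)).
Qed.

Lemma cubemap_cell i (v : 'rV[R]_(cdim i)) : `|v| < 1 -> cell i (cubemap v).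
Proof. by move=> v1; apply/cellP; exists v. Qed.

Lemma cubemap_boundary i (v : 'rV[R]_(cdim i)) :
  `|v| = 1 -> cell_boundary i (cubemap v).
Proof.
move=> v1; exists (radial (fun v => `|v|) (@enorm R _) v) => //.
by apply/sphere_enorm; rewrite enorm_radial.
Qed.

Lemma cell_uniq i j y : cell i y -> cell j y -> i = j.
Proof.
by move=> iy jy; apply: (cells_disjoint (c := s)) => //; exists y.
Qed.

Lemma cell_notin i y : cell i y -> ~ A y.
Proof.
by move=> iy; have : (~` A) y by rewrite -(cells_cover s); exists i.
Qed.

Lemma notin_cell y : ~ A y -> exists i, cell i y.
Proof.
by move=> Ay; have : (~` A) y by []; rewrite -(cells_cover s) => -[i _ ?]; exists i.
Qed.

End cubes.

(** * Connectivity of relative cell complexes *)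

Section connectivity.
Variables (R : realType) (X : topologicalType) (A : set X).
Variable s : cell_structure R A.
Hypotheses (hX : hausdorff_space X) (s_cc : is_cell_complex s).
Implicit Types (i j : 'I_(ncells s)) (y : X).

Definition stage (m : nat) : set X :=
  A `|` \bigcup_(j in [set j : 'I_(ncells s) | (j < m)%N]) cell j.

Definition closed_cube n : set 'rV[R]_n := [set v | `|v| <= 1].

Lemma stage_cell i y : stage i y -> ~ cell i y.
Proof.
move=> [Ay /cell_notin//|[j /= ji jy] iy].
by move: ji; rewrite (cell_uniq iy jy) ltnn.
Qed.

Lemma cubemap_stage i (v : 'rV[R]_(cdim i)) : `|v| = 1 -> stage i (cubemap v).
Proof. by move=> v1; apply: s_cc; exact: cubemap_boundary. Qed.

Lemma stageSE i :
  stage i.+1 = stage i `|` @cubemap _ _ _ s i @` @closed_cube (cdim i).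
Proof.
apply/seteqP; split => [y [Ay|[j /= ji jy]]|y [[Ay|[j /= ji jy]]|[v]]].
- by left; left.
- move: ji; rewrite ltnS leq_eqVlt => /orP[/eqP/val_inj ji|ji]; last first.
    by left; right; exists j.
  subst j; right; move/cellP: jy => [v v1 <-].
  by exists v => //; exact/ltW.
- by left.
- by right; exists j => //=; exact: leqW.
- rewrite /closed_cube /= le_eqVlt => /orP[/eqP v1|v1] <-.
    case: (cubemap_stage v1) => [?|[j /= ji ?]]; first by left.
    by right; exists j => //=; exact: leqW.
  by right; exists i => //=; exact: cubemap_cell.
Qed.

Lemma closed_cube_compact n : compact (@closed_cube n).
Proof. exact: (gauge_compact (gauge_norm R n)). Qed.

Lemma closed_cubemap i : closed (@cubemap _ _ _ s i @` @closed_cube (cdim i)).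
Proof.
apply: compact_closed => //; apply: continuous_compact.
  exact: cubemap_continuous.
exact: closed_cube_compact.
Qed.

Lemma stage_closed m : (m <= ncells s)%N -> closed (stage m).
Proof.
elim: m => [_|m IH mn].
  have -> : stage 0 = A; last exact: base_closed s.
  by apply/seteqP; split => [y [//|[j]]|y Ay] //; left.
have -> : stage m.+1 = stage (Ordinal mn).+1 by [].
by rewrite stageSE; apply: closedU; [exact/IH/ltnW|exact: closed_cubemap].
Qed.

Lemma stage_full : stage (ncells s) = setT.
Proof.
apply/seteqP; split => // y _; have [Ay|/(notin_cell s)[i iy]] := pselect (A y).
  by left.
by right; exists i => //=.
Qed.

Section push.
Variable i : 'I_(ncells s).
Let m := cdim i.
Let chi : 'rV[R]_m -> X := @cubemap _ _ _ s i.

Definition cubeinv y : 'rV[R]_m := xget 0 [set v | `|v| < 1 /\ chi v = y].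

(** The distance from the centre of the cell, extended by 1. *)
Definition cuberad y : R := if `[< cell i y >] then `|cubeinv y| else 1.

Lemma cubeinvK v : `|v| < 1 -> cubeinv (chi v) = v.
Proof.
move=> v1; rewrite /cubeinv; case: xgetP => [w _ [w1 E]|/(_ v)/=]; last by case.
exact: (cubemap_inj w1 v1).
Qed.

Lemma cuberad_cube v : `|v| <= 1 -> cuberad (chi v) = `|v|.
Proof.
rewrite /cuberad le_eqVlt => /orP[/eqP v1|v1].
  rewrite asboolF ?v1 //; apply: stage_cell; exact: cubemap_stage.
by rewrite asboolT ?cubeinvK //; exact: cubemap_cell.
Qed.

Lemma cuberad_stage y : stage i y -> cuberad y = 1.
Proof. by move=> /stage_cell iy; rewrite /cuberad asboolF. Qed.

Lemma cuberad_lt1 y : cuberad y < 1 ->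
  [/\ cell i y, chi (cubeinv y) = y & `|cubeinv y| = cuberad y].
Proof.
rewrite /cuberad; case: asboolP => [iy y1|_]; last by rewrite ltxx.
by split => //; case/cellP: iy => v v1 <-; rewrite cubeinvK.
Qed.

Lemma cuberad_cell y : cell i y -> cuberad y < 1.
Proof. by move=> /cellP[v v1 <-]; rewrite cuberad_cube // ltW. Qed.

(** Both pieces of the stage are closed, and the closed cell carries the
    quotient topology of the cube. *)
Lemma cuberad_continuous : {within stage i.+1, continuous cuberad}.
Proof.
rewrite stageSE; apply: withinU_continuous.
- by apply: stage_closed; exact/ltnW.
- exact: closed_cubemap.
- apply: (within_eq (f := fun=> 1 : R)) => [y iy|]; first by rewrite cuberad_stage.
  by apply: continuous_subspaceT; exact: cst_continuous.
- apply: within_quotient => //.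
  + exact: closed_cube_compact.
  + exact: cubemap_continuous.
  apply: (within_eq (f := fun v : 'rV[R]_m => `|v|)) => [v v1|].
    by rewrite /= cuberad_cube.
  by apply: continuous_subspaceT; exact: norm_continuous.
Qed.

Lemma cubeinv_continuous :
  {within chi @` [set v | `|v| <= 1 / 2], continuous cubeinv}.
Proof.
have sub : [set v : 'rV[R]_m | `|v| <= 1 / 2] `<=` @closed_cube m.
  by move=> v /= v2; rewrite /closed_cube /=; lra.
apply: within_quotient => //.
- exact: (gauge_compact (gauge_norm R m)).
- by apply: continuous_subspaceW sub _; exact: cubemap_continuous.
- apply: (within_eq (f := id)) => [v /= v2|]; first by rewrite cubeinvK //; lra.
  by apply: continuous_subspaceT => v; exact: cvg_id.
Qed.

(** The radial homotopy, meaningful away from the centre of the cell: at time t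
    a vector of norm r has been moved to norm (1 - t) * r + t. *)
Definition push (p : R * X) : X :=
  if `[< cell i p.2 >] then
    chi (((1 - p.1) + p.1 / `|cubeinv p.2|) *: cubeinv p.2)
  else p.2.

Let annulus : set 'rV[R]_m := [set v | 1 / 2 <= `|v| <= 1].

Lemma push_cube t v : annulus v ->
  push (t, chi v) = chi (((1 - t) + t / `|v|) *: v).
Proof.
move=> /andP[v2]; rewrite le_eqVlt => /orP[/eqP v1|v1]; rewrite /push /=.
  rewrite asboolF; last by apply: stage_cell; exact: cubemap_stage.
  by rewrite v1 divr1 subrK scale1r.
by rewrite asboolT ?cubeinvK //; exact: cubemap_cell.
Qed.

Lemma push_norm t (v : 'rV[R]_m) : 0 <= t <= 1 -> 0 < `|v| ->
  `|((1 - t) + t / `|v|) *: v| = (1 - t) * `|v| + t.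
Proof.
move=> /andP[t0 t1] v0; rewrite normrZ ger0_norm; last first.
  by rewrite addr_ge0 // ?subr_ge0 // divr_ge0.
by rewrite mulrDl divfK // gt_eqF.
Qed.

Lemma push_continuous :
  {within `[0, 1]%classic `*` (stage i.+1 `&` [set y | 1 / 2 <= cuberad y]),
    continuous push}.
Proof.
pose K : set (R * 'rV[R]_m) := `[0, 1]%classic `*` annulus.
pose q (p : R * 'rV[R]_m) := (p.1, chi p.2).
have cann : compact annulus.
  have -> : annulus = @closed_cube m `&` (fun v => `|v|) @^-1` [set t | 1 / 2 <= t].
    apply/seteqP; rewrite /annulus /closed_cube.
    by split => v /=; [move=> /andP[]|move=> [-> ->]].
  apply: compact_closedI; first exact: closed_cube_compact.
  by apply: preimage_closed; [move=> v _; exact: norm_continuous|exact: closed_ge].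
have cK : compact K by apply: compact_setX => //; exact: segment_compact.
have qc : {within K, continuous q}.
  apply: within_pair; first by apply: continuous_subspaceT => p; exact: cvg_fst.
  apply: (within_comp (f := snd) _ _ (@cubemap_continuous _ _ _ s i)).
    by move=> _ [[t v] /= [_ /andP[_ v1]] <-].
  by apply: continuous_subspaceT => p; exact: cvg_snd.
have cqK : closed (q @` K).
  apply: compact_closed; last exact: continuous_compact.
  by apply: hausdorff_prod => //; exact: Rhausdorff.
have cB : closed ((`[0, 1]%classic : set R) `*` stage i).
  have -> : (`[0, 1]%classic : set R) `*` stage i =
     (fst @^-1` `[0, 1]%classic) `&` (snd @^-1` stage i) by [].
  apply: closedI; apply: preimage_closed.
  - by move=> p _; exact: cvg_fst.
  - exact: itv_closed.
  - by move=> p _; exact: cvg_snd.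
  - by apply: stage_closed; exact: ltnW.
apply: (@continuous_subspaceW _ _ _ ((`[0, 1]%classic `*` stage i) `|` q @` K)).
  move=> [t y] /= [t01 []]; rewrite stageSE => -[iy _|[v v1 <-]]; first by left.
  rewrite cuberad_cube // => v2; right; exists (t, v) => //.
  by split => //=; apply/andP.
apply: withinU_continuous => //.
  apply: (within_eq (f := snd)) => [[t y] [_ /= /stage_cell iy]|].
    by rewrite /push /= asboolF.
  by apply: continuous_subspaceT => p; exact: cvg_snd.
apply: within_quotient => //.
  by apply: hausdorff_prod => //; exact: Rhausdorff.
pose sc (p : R * 'rV[R]_m) := ((1 - p.1) + p.1 / `|p.2|) *: p.2.
apply: (within_eq (f := chi \o sc)) => [[t v] [_ /= av]|].
  by rewrite /q /= push_cube.
apply: (within_comp _ _ (@cubemap_continuous _ _ _ s i)).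
  move=> _ [[t v] /= [+ /andP[v2 v1]] <-]; rewrite /= in_itv /= => t01.
  rewrite /sc /= push_norm //; last by lra.
  have /andP[t0 t1] := t01.
  have : (1 - t) * `|v| <= (1 - t) * 1 by rewrite ler_wpM2l // subr_ge0.
  lra.
apply: continuous_in_subspaceT => -[t v] /set_mem [/= _ /andP[v2 v1]].
have v0 : `|v| != 0 by rewrite gt_eqF //; lra.
apply: (@continuousZ _ _ _ (fun p : R * 'rV[R]_m => (1 - p.1) + p.1 / `|p.2|) snd);
  last exact: cvg_snd.
apply: (@continuousD _ _ _ (fun p : R * 'rV[R]_m => 1 - p.1)
  (fun p : R * 'rV[R]_m => p.1 / `|p.2|)).
  apply: (@continuousB _ _ _ (fun=> 1 : R) (fun p : R * 'rV[R]_m => p.1)).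
    exact: cst_continuous.
  exact: cvg_fst.
apply: (@continuousM _ _ (fun p : R * 'rV[R]_m => p.1)
  (fun p : R * 'rV[R]_m => `|p.2|^-1)); first exact: cvg_fst.
apply: (@continuousV _ _ (fun p : R * 'rV[R]_m => `|p.2|)) => //.
by apply: (@continuous_comp _ _ _ snd); [exact: cvg_snd|exact: norm_continuous].
Qed.

End push.
End connectivity.

Section cell_by_cell.
Variables (R : realType) (X : topologicalType) (A : set X).
Variable s : cell_structure R A.
Hypotheses (hX : hausdorff_space X) (s_cc : is_cell_complex s).

Let clamp (t : R) : R := Num.max 0 (Num.min 1 t).

Let clamp_continuous : continuous clamp.
Proof.
apply: (@max_fun_continuous _ _ R (fun=> 0)); first exact: cst_continuous.
apply: (@min_fun_continuous _ _ R (fun=> 1) id); first exact: cst_continuous.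
by move=> t; exact: cvg_id.
Qed.

(** In the coordinates u of the cell, u' is a nonvanishing approximation of u,
    and w interpolates from u' near the centre to u at norm 1 / 2 and beyond.
    It does not vanish: where it differs from u', the norm of u exceeds 1 / 4,
    while w stays within 1 / 4 of u. The homotopy goes along line segments from
    u to the direction of w, which is a point of the boundary of the cube; from
    norm 1 / 2 on it is the radial one, so it extends by the identity outside
    the cell. *)
Lemma push_off_cell (i : 'I_(ncells s)) k (g : 'rV[R]_k -> X) :
  (k < cdim i)%N -> {within disk R k, continuous g} ->
  g @` disk R k `<=` stage s i.+1 -> g @` sphere R k `<=` A ->
  exists2 g', homotopic_rel g g' & g' @` disk R k `<=` stage s i.
Proof.
move=> ki gc gD gS.
pose chi : 'rV[R]_(cdim i) -> X := @cubemap _ _ _ s i.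
pose rho z := cuberad i (g z).
have rhoc : {within disk R k, continuous rho}.
  exact: (within_comp _ gc (cuberad_continuous hX s_cc (i := i))).
pose K := disk R k `&` rho @^-1` [set t | t <= 1 / 2].
pose Q := disk R k `&` rho @^-1` [set t | 1 / 2 <= t].
have cK : compact K.
  by apply: compact_within_preimage => //; exact: disk_compact.
have cQ : compact Q.
  by apply: compact_within_preimage => //; exact: disk_compact.
have KD : K `<=` disk R k by move=> z [].
have KP z : K z -> [/\ cell i (g z), chi (cubeinv i (g z)) = g z &
    `|cubeinv i (g z)| = rho z].
  by move=> [_ /= zK]; apply: cuberad_lt1; rewrite -/(rho z); lra.
pose u z := cubeinv i (g z).
have uc : {within K, continuous u}.
  apply: (within_comp _ _ (cubeinv_continuous hX (i := i))).
    move=> _ [z Kz <-]; have [_ E1 E2] := KP z Kz.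
    by exists (cubeinv i (g z)) => //=; rewrite E2; case: Kz.
  exact: continuous_subspaceW gc.
have e4 : 0 < 1 / 4 :> R by lra.
have [u' [u'c Hu']] := nonvanishing_approx ki cK uc e4.
(* Equal to 1 up to norm 1 / 4 and to 0 from norm 1 / 2 on. *)
pose lam z := clamp (2 - 4 * rho z).
have lam01 z : 0 <= lam z <= 1.
  by rewrite /lam /clamp le_max lexx /= ge_max ler01 ge_min lexx.
have lam0 z : 1 / 2 <= rho z -> lam z = 0.
  by move=> zr; rewrite /lam /clamp max_l // ge_min; apply/orP; right; lra.
have lam1 z : rho z <= 1 / 4 -> lam z = 1.
  by move=> zr; rewrite /lam /clamp min_l; [rewrite max_r|lra].
pose w z := u z + lam z *: (u' z - u z).
have normu z : K z -> `|u z| = rho z by move=> /KP[].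
have normw z : K z -> 0 < `|w z|.
  move=> Kz; have [u'e u'0] := Hu' z Kz; have [r4|r4] := leP (rho z) (1 / 4).
    by rewrite /w lam1 // scale1r subrKC normr_gt0.
  have : `|u z| <= `|w z| + `|lam z *: (u' z - u z)|.
    by rewrite (le_trans _ (ler_normB _ _)) // /w addrK.
  rewrite normu // normrZ; have /andP[l0 l1] := lam01 z.
  rewrite (ger0_norm l0).
  have : lam z * `|u' z - u z| <= 1 * `|u' z - u z| by rewrite ler_wpM2r.
  lra.
have wc : {within K, continuous w}.
  have lamc : {within K, continuous lam}.
    apply: (within_comp (f := rho) (B := setT) (g := fun t => clamp (2 - 4 * t))) => //.
      exact: continuous_subspaceW rhoc.
    apply: continuous_subspaceT => t.
    apply: (@continuous_comp _ _ _ (fun t : R => 2 - 4 * t) clamp).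
      apply: (@continuousB _ _ _ (fun=> 2 : R) (fun t : R => 4 * t)).
        exact: cst_continuous.
      exact: mulrl_continuous.
    exact: clamp_continuous.
  have u'c' : {within K, continuous u'} by exact: continuous_subspaceT.
  move=> z; apply: cvgD; first exact: uc.
  by apply: cvgZ; [exact: lamc|apply: cvgB; [exact: u'c'|exact: uc]].
(* The segment from u to the boundary point w / `|w|. *)
pose h (p : R * 'rV[R]_k) := (1 - p.1) *: u p.2 + (p.1 / `|w p.2|) *: w p.2.
pose H (p : R * 'rV[R]_k) : X :=
  if rho p.2 <= 1 / 2 then chi (h p) else push i (p.1, g p.2).
have HQ t z : Q z -> H (t, z) = push i (t, g z).
  move=> [Dz /= rz]; rewrite /H /=; case: ifPn => // rz'.
  have rE : rho z = 1 / 2 by apply/le_anti/andP.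
  have Kz : K z by [].
  have [iz E1 E2] := KP z Kz.
  rewrite /h /= /w lam0 // scale0r addr0 -scalerDl.
  by rewrite /push /= asboolT.
have wn z : K z -> `|(1 / `|w z|) *: w z| = 1.
  move=> Kz; rewrite normrZ ger0_norm ?divr_ge0 //.
  by rewrite div1r mulVf // gt_eqF // normw.
have tI : closed (`[0, 1]%classic : set R) by exact: itv_closed.
have cprod (B : set 'rV[R]_k) : compact B -> closed ((`[0, 1]%classic : set R) `*` B).
  move=> cB; apply: compact_closed.
    by apply: hausdorff_prod; [exact: Rhausdorff|exact: norm_hausdorff].
  by apply: compact_setX => //; exact: segment_compact.
have c1 (B : set (R * 'rV[R]_k)) : {within B, continuous fst}.
  by apply: continuous_subspaceT => p; exact: cvg_fst.
have c2 (B : set (R * 'rV[R]_k)) : {within B, continuous snd}.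
  by apply: continuous_subspaceT => p; exact: cvg_snd.
exists (fun z => H (1, z)).
  exists H; split => //.
  - have -> : (`[0, 1]%classic : set R) `*` disk R k =
        `[0, 1]%classic `*` K `|` `[0, 1]%classic `*` Q.
      rewrite eqEsubset; split => -[t z] /=; last by move=> [] [? [? _]].
      by move=> [t01 Dz]; have [rz|/ltW rz] := leP (rho z) (1 / 2); [left|right].
    apply: (within_paste (f := chi \o h) (g := fun p => push i (p.1, g p.2))).
    + exact: cprod.
    + exact: cprod.
    + apply: (within_comp _ _ (@cubemap_continuous _ _ _ s i)).
        move=> _ [[t z] [/= + Kz] <-]; rewrite /= in_itv /= => /andP[t0 t1].
        rewrite /= (_ : h (t, z) =
          (1 - t) *: u z + t *: ((1 / `|w z|) *: w z)); last first.
          by rewrite scalerA div1r.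
        apply: (le_trans (ler_normD _ _)); rewrite normrZ [X in _ + X]normrZ wn //.
        rewrite ger0_norm ?subr_ge0 //.
        rewrite ger0_norm // normu //; case: Kz => _ /= rz.
        have : (1 - t) * rho z <= (1 - t) * 1.
          by rewrite ler_wpM2l ?subr_ge0 //; lra.
        lra.
      have us : {within (`[0, 1]%classic : set R) `*` K,
          continuous (fun p : R * 'rV[R]_k => u p.2)}.
        by apply: (within_comp (f := snd) _ (c2 _) uc); move=> _ [[t z] [_ ?] <-].
      have ws : {within (`[0, 1]%classic : set R) `*` K,
          continuous (fun p : R * 'rV[R]_k => w p.2)}.
        by apply: (within_comp (f := snd) _ (c2 _) wc); move=> _ [[t z] [_ ?] <-].
      have wV : {within (`[0, 1]%classic : set R) `*` K,
          continuous (fun p : R * 'rV[R]_k => `|w p.2|^-1)}.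
        rewrite continuous_subspace_in => p /set_mem [_ Kz].
        apply: cvgV; first by rewrite gt_eqF // normw.
        by apply: cvg_norm; exact: ws.
      move=> p; apply: cvgD.
        apply: cvgZ; last exact: us.
        by apply: cvgB; [exact: cvg_cst|exact: c1].
      apply: cvgZ; last exact: ws.
      by apply: cvgM; [exact: c1|exact: wV].
    + apply: (within_comp (f := fun p => (p.1, g p.2)) _ _
        (push_continuous hX s_cc (i := i))).
        move=> _ [[t z] [/= t01 [Dz rz]] <-] /=; split => //; split => //.
        by apply: gD; exists z.
      apply: within_pair => //; apply: (within_comp (f := snd) _ (c2 _) gc).
      by move=> _ [[t z] [_ [? _]] <-].
    + by move=> [t z] [_ [Dz /= rz]]; rewrite /H /= ifT.
    + by move=> [t z] [_ Qz] /=; rewrite HQ.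
  - move=> z Dz; have [rz|/ltW rz] := leP (rho z) (1 / 2).
      rewrite /H /= ifT // /h /= subr0 scale1r mul0r scale0r addr0.
      by case: (KP z).
    rewrite HQ // /push /= subr0 mul0r addr0 scale1r.
    case: asboolP => // iz; case: (cuberad_lt1 (cuberad_cell s_cc iz)) => _ -> //.
  - move=> t z t01 Sz; have Dz := sphere_disk Sz.
    have Ag : A (g z) by apply: gS; exists z.
    have rz : rho z = 1 by rewrite /rho (cuberad_stage) //; left.
    rewrite HQ; last by split => //=; rewrite rz; lra.
    by rewrite /push /= asboolF // => /cell_notin.
move=> _ [z Dz <-]; have [rz|/ltW rz] := leP (rho z) (1 / 2).
  rewrite /H /= ifT // /h /= subrr scale0r add0r.
  by apply: (cubemap_stage s_cc); rewrite wn.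
rewrite HQ // /push /=; case: asboolP => [iz|iz].
  have [_ _ E] := cuberad_lt1 (cuberad_cell s_cc iz).
  apply: (cubemap_stage s_cc); rewrite subrr add0r normrZ.
  rewrite -/(rho z) in E.
  rewrite ger0_norm ?divr_ge0 // div1r mulVf // E gt_eqF //; lra.
have : stage s i.+1 (g z) by apply: gD; exists z.
case=> [Ag|[j /= ji jz]]; first by left.
right; exists j => //=; move: ji; rewrite ltnS leq_eqVlt => /orP[/eqP/val_inj ji|//].
by subst j.
Qed.

Lemma deform_stage k m (g : 'rV[R]_k -> X) :
  (forall i : 'I_(ncells s), (k < cdim i)%N) -> (m <= ncells s)%N ->
  {within disk R k, continuous g} -> g @` disk R k `<=` stage s m ->
  g @` sphere R k `<=` A ->
  exists2 g', homotopic_rel g g' & g' @` disk R k `<=` A.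
Proof.
move=> kd; elim: m g => [|m IH] g mn gc gD gS.
  exists g; first exact: homotopic_rel_refl.
  by move=> y /gD [//|[]].
have [g' gg' g'D] := @push_off_cell (Ordinal mn) k g (kd _) gc gD gS.
have [H [Hc H0 H1 Hs]] := gg'.
have [|||g'' g'g'' g''A] := IH g' (ltnW mn); last 1 first.
- by exists g'' => //; exact: homotopic_rel_trans g'g''.
- have : {within disk R k, continuous (fun x => H (1, x))}.
    apply: (within_comp (f := fun x : 'rV[R]_k => (1 : R, x)) _ _ Hc).
      by move=> _ [x Dx <-]; split => //=; rewrite in_itv /= lexx ler01.
    apply: continuous_subspaceT; apply: continuous_pair.
      exact: cst_continuous.
    by move=> x; exact: cvg_id.
  exact: within_eq.
- exact: g'D.
- move=> _ [x Sx <-]; rewrite -H1 ?Hs //; [|by rewrite lexx ler01|exact: sphere_disk].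
  by apply: gS; exists x.
Qed.

(** A map from a disk of dimension smaller than that of all cells can be
    pushed off the cells, starting with the one attached last. *)
Lemma connected_pair_cell_complex (n : nat) :
  (forall i : 'I_(ncells s), (n <= cdim i)%N) -> connected_pair R (n%:Z - 1) A.
Proof.
move=> dn k g kn gc gS.
have kd (i : 'I_(ncells s)) : (k < cdim i)%N.
  apply: (leq_trans _ (dn i)); rewrite -ltz_nat.
  by move: kn; rewrite lerBrDr -lezD1.
have [|g' [H [Hc H0 H1 Hs]] g'A] := deform_stage kd (leqnn _) gc _ gS.
  by rewrite stage_full.
by exists H; split => // x Dx; rewrite H1 //; apply: g'A; exists x.
Qed.

End cell_by_cell.

(** * Coordinates of a point *)

Section coordinates.
Variables (R : realType) (U : topologicalType).
Local Notation Us := (one_point_compactification U).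
Variable s : cell_structure R (set0 : set Us).
Implicit Types (y : Us) (i : 'I_(ncells s)).

Definition cellidx y : 'I_(ncells s) :=
  projT1 (cid (notin_cell s (fun h : set0 y => h))).

Lemma cellidxP y : cell (cellidx y) y.
Proof. by rewrite /cellidx; case: cid. Qed.

Lemma cellidx_uniq i y : cell i y -> cellidx y = i.
Proof. by move=> iy; exact: cell_uniq (cellidxP y) iy. Qed.

Definition maxdim : nat := \max_i cdim (c := s) i.

Lemma cdim_le i : (cdim i <= maxdim)%N.
Proof. exact: (@leq_bigmax _ (fun i => cdim (c := s) i)). Qed.

(** The coordinates of a point in the cube of its cell, padded with zeros so
    that the points of all cells have coordinates with the same indices. *)
Definition coord y (c : 'I_maxdim) : R :=
  if insub (c : nat) is Some j then cubeinv (cellidx y) y ord0 j else 0.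

Definition of_coord i (q : 'I_maxdim -> R) : Us :=
  cubemap (\row_(j < cdim i) q (widen_ord (cdim_le i) j)).

Lemma coordE i y c : cellidx y = i ->
  coord y c = if insub (c : nat) is Some j then cubeinv i y ord0 j else 0.
Proof. by move=> <-. Qed.

Lemma cubeinv_cell i y : cell i y ->
  `|cubeinv i y| < 1 /\ cubemap (cubeinv i y) = y.
Proof. by case/cellP => v v1 <-; rewrite cubeinvK. Qed.

Lemma coord_lt1 y c : `|coord y c| < 1.
Proof.
rewrite /coord; case: insubP => [j _ _|_]; last by rewrite normr0.
by apply: le_lt_trans (cubeinv_cell (cellidxP y)).1; exact: rV_norm_coord.
Qed.

Lemma coord_out y (c : 'I_maxdim) : (cdim (cellidx y) <= c)%N -> coord y c = 0.
Proof. by rewrite /coord leqNgt; case: insubP => // j ->. Qed.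

Lemma coordK y : of_coord (cellidx y) (coord y) = y.
Proof.
rewrite /of_coord (_ : \row__ _ = cubeinv (cellidx y) y).
  exact: (cubeinv_cell (cellidxP y)).2.
apply/rowP => j; rewrite mxE /coord insubT //= => jd.
by congr (_ ord0 _); apply: val_inj.
Qed.

Lemma of_coordK i q : (forall c, `|q c| < 1) ->
  (forall c : 'I_maxdim, (cdim i <= c)%N -> q c = 0) ->
  cellidx (of_coord i q) = i /\ forall c, coord (of_coord i q) c = q c.
Proof.
move=> q1 q0; set v := \row_(j < cdim i) q (widen_ord (cdim_le i) j).
have v1 : `|v| < 1 by apply/rV_norm_lt => // j; rewrite mxE.
have E : cellidx (of_coord i q) = i by apply: cellidx_uniq; exact: cubemap_cell.
split => // c; rewrite (coordE _ E); case: insubP => [j _ jc|].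
  rewrite /of_coord cubeinvK // mxE; congr (q _); exact: val_inj.
by rewrite -leqNgt => /q0.
Qed.

Lemma of_coord_continuous (T : topologicalType) (A : set T) i
    (q : T -> 'I_maxdim -> R) :
  (forall c, {within A, continuous (fun x => q x c)}) ->
  (forall x c, A x -> `|q x c| <= 1) ->
  {within A, continuous (fun x => of_coord i (q x))}.
Proof.
move=> qc q1.
apply: (within_comp (f := fun x => \row_(j < cdim i) q x (widen_ord (cdim_le i) j))
  _ _ (@cubemap_continuous _ _ _ s i)).
  by move=> _ [x Ax <-]; apply/rV_norm_le => // j; rewrite mxE; exact: q1.
apply: within_rV => j; apply: within_eq (qc (widen_ord (cdim_le i) j)) => x _.
by rewrite mxE.
Qed.

Lemma of_coord_dim i q : is_CW_complex s -> (forall c, `|q c| <= 1) ->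
  (cdim (cellidx (of_coord i q)) <= cdim i)%N.
Proof.
move=> s_CW q1; set v := \row_(j < cdim i) q (widen_ord (cdim_le i) j).
have : `|v| <= 1 by apply/rV_norm_le => // j; rewrite mxE.
rewrite le_eqVlt => /orP[/eqP/cubemap_boundary|/cubemap_cell/cellidx_uniq ->//].
by move=> /(s_CW.2 i)[//|[j /= ji /cellidx_uniq ->]]; exact: ltnW.
Qed.

Lemma of_coord_dim_lt i q (c : 'I_maxdim) :
  is_CW_complex s -> (forall c, `|q c| <= 1) -> (c < cdim i)%N -> `|q c| = 1 ->
  (cdim (cellidx (of_coord i q)) < cdim i)%N.
Proof.
move=> s_CW q1 ci qc; set v := \row_(j < cdim i) q (widen_ord (cdim_le i) j).
have v1 : `|v| = 1.
  apply/le_anti/andP; split; first by apply/rV_norm_le => // j; rewrite mxE.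
  apply: le_trans (rV_norm_coord v (Ordinal ci)); rewrite mxE.
  by rewrite (_ : widen_ord _ _ = c) ?qc //; apply: val_inj.
by move/cubemap_boundary: v1 => /(s_CW.2 i)[//|[j /= ji /cellidx_uniq ->]].
Qed.

Section basepoint.
Hypothesis s_pt : is_only_zero_cell s None.

Lemma cellidx_None y : cellidx y = cellidx None -> y = None.
Proof.
case: s_pt => i0 i0E _ E; have N0 : cellidx None = i0.
  by apply: cellidx_uniq; rewrite i0E.
by have := cellidxP y; rewrite E N0 i0E.
Qed.

Lemma cdim_gt0 y : y <> None -> (0 < cdim (cellidx y))%N.
Proof.
case: s_pt => i0 i0E i0d yN; rewrite lt0n; apply/eqP => /i0d E; apply: yN.
by have := cellidxP y; rewrite E i0E.
Qed.

End basepoint.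

End coordinates.
Arguments coord {R U} s y c.

(** * Combinatorial types of configurations *)

Section types.
Variables (R : realType) (U : topologicalType).
Local Notation Us := (one_point_compactification U).
Variable s : cell_structure R (set0 : set Us).
Variable N : finType.
Local Notation D := (maxdim s).
Implicit Types (f : pt_power U N) (x y : N) (c : 'I_D) (p : N * 'I_D).

(** The second component records the relations [same] and [before] below. *)
Definition comb_type : finType :=
  ({ffun N -> 'I_(ncells s)} * {ffun N * N * 'I_D -> bool * bool})%type.
Implicit Type t : comb_type.

Definition same f x y c := cellidx s (f x) = cellidx s (f y) /\
  forall c', (c' <= c)%N -> coord s (f x) c' = coord s (f y) c'.

(** The point x precedes y lexicographically in a common cell, and c is the
    first coordinate in which they differ. *)
Definition before f x y c := [/\ cellidx s (f x) = cellidx s (f y),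
  forall c', (c' < c)%N -> coord s (f x) c' = coord s (f y) c' &
  coord s (f x) c < coord s (f y) c].

Definition typ f : comb_type :=
  ([ffun x => cellidx s (f x)],
   [ffun q => (`[< same f q.1.1 q.1.2 q.2 >], `[< before f q.1.1 q.1.2 q.2 >])]).

Definition tlabel t x : 'I_(ncells s) := t.1 x.
Definition tsame t x y c : bool := (t.2 (x, y, c)).1.
Definition tbefore t x y c : bool := (t.2 (x, y, c)).2.

Lemma tlabelE f x : tlabel (typ f) x = cellidx s (f x).
Proof. by rewrite /tlabel ffunE. Qed.

Lemma tsameP f x y c : reflect (same f x y c) (tsame (typ f) x y c).
Proof. by rewrite /tsame ffunE; exact: asboolP. Qed.

Lemma tbeforeP f x y c : reflect (before f x y c) (tbefore (typ f) x y c).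
Proof. by rewrite /tbefore ffunE; exact: asboolP. Qed.

Lemma typ_eq f g : (forall x, cellidx s (f x) = cellidx s (g x)) ->
  (forall x y c, same f x y c <-> same g x y c) ->
  (forall x y c, before f x y c <-> before g x y c) -> typ f = typ g.
Proof.
move=> fg1 fg2 fg3; congr (_, _); apply/ffunP; first by move=> x; rewrite !ffunE.
by move=> q; rewrite !ffunE; congr (_, _); apply: asbool_equiv_eq.
Qed.

Lemma same_refl f x c : same f x x c. Proof. by split. Qed.

Lemma same_sym f x y c : same f x y c -> same f y x c.
Proof. by move=> [h1 h2]; split => // c' /h2. Qed.

Lemma same_trans f x y z c : same f x y c -> same f y z c -> same f x z c.
Proof.
move=> [h1 h2] [h3 h4]; split; first by rewrite h1.
by move=> c' cc; rewrite h2 // h4.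
Qed.

Lemma same_le f x y c (c' : 'I_D) : (c' <= c)%N -> same f x y c -> same f x y c'.
Proof. by move=> cc [h1 h2]; split => // e /leq_trans/(_ cc)/h2. Qed.

(** The first coordinate where two points of the same cell differ orders
    them. *)
Lemma before_total f x y c : cellidx s (f x) = cellidx s (f y) ->
  coord s (f x) c <> coord s (f y) c ->
  exists2 c' : 'I_D, (c' <= c)%N & before f x y c' \/ before f y x c'.
Proof.
move=> xy cxy; have [c' /= c'P c'min] := @arg_minnP _ c
  (fun c : 'I_D => coord s (f x) c != coord s (f y) c) (fun c : 'I_D => c : nat)
  (introN eqP cxy).
have eqc (e : 'I_D) : (e < c')%N -> coord s (f x) e = coord s (f y) e.
  by move=> ec; apply/eqP; apply: contraLR ec => /c'min; rewrite -leqNgt.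
exists c'; first by apply: c'min; exact/eqP.
case: (ltgtP (coord s (f x) c') (coord s (f y) c')) c'P => // H _; [left|right].
  by split.
by split => // e /eqc.
Qed.

(** Two points of the same cell agreeing in the coordinates 0, ..., c share
    their coordinate c. The free coordinates of a configuration are thus the
    classes of pairs of a point and one of its coordinates; a class is encoded
    by a chosen element. *)
Definition class_rep t p : N * 'I_D :=
  (odflt p.1 [pick y | tsame t p.1 y p.2], p.2).

Definition valid t p := (p.2 < cdim (tlabel t p.1))%N.

Definition class_reps t : pred (N * 'I_D) := [pred p | valid t p & class_rep t p == p].

Definition tdim t := #|class_reps t|.

Lemma class_rep_same f p : same f p.1 (class_rep (typ f) p).1 p.2.
Proof.
rewrite /class_rep; case: pickP => [y /tsameP //|/= _]; exact: same_refl.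
Qed.

Lemma class_rep_eqP f x y c (c' : 'I_D) :
  class_rep (typ f) (x, c) = class_rep (typ f) (y, c') <->
  c = c' /\ same f x y c.
Proof.
split=> [E|[<- xy]].
  have cc : c = c' by case: E.
  split => //; subst c'; apply: same_trans (class_rep_same f (x, c)) _; rewrite E.
  exact/same_sym/(class_rep_same f (y, c)).
have E z : tsame (typ f) x z c = tsame (typ f) y z c.
  apply/tsameP/tsameP; last exact: same_trans.
  exact/same_trans/same_sym.
rewrite /class_rep /= (eq_pick E); case: pickP => // /(_ y) /tsameP[].
exact: same_refl.
Qed.

Lemma class_repK f p :
  class_rep (typ f) (class_rep (typ f) p) = class_rep (typ f) p.
Proof.
case: p => x c; rewrite [in LHS](surjective_pairing (class_rep _ (x, c))).
by apply/class_rep_eqP; split => //; exact/same_sym/(class_rep_same f (x, c)).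
Qed.

Lemma valid_same f x y c :
  same f x y c -> valid (typ f) (x, c) = valid (typ f) (y, c).
Proof. by rewrite /valid /= !tlabelE => -[->]. Qed.

Lemma valid_class_rep f p :
  valid (typ f) (class_rep (typ f) p) = valid (typ f) p.
Proof.
case: p => x c; rewrite [in LHS](surjective_pairing (class_rep _ (x, c))).
by symmetry; apply: valid_same; exact: (class_rep_same f (x, c)).
Qed.

Lemma class_rep_in f p :
  valid (typ f) p -> class_reps (typ f) (class_rep (typ f) p).
Proof. by move=> vp; rewrite /class_reps /= valid_class_rep vp class_repK eqxx. Qed.

Lemma before_valid f x y c : before f x y c -> valid (typ f) (x, c).
Proof.
move=> [xy _ lxy]; rewrite /valid /= tlabelE ltnNge; apply/negP => h.
by move: lxy; rewrite !coord_out ?ltxx // -xy.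
Qed.

Lemma configP f : Conf setT f <-> injective f /\ forall x, f x <> None.
Proof.
split=> -[fi fU]; split => // x; first by case: (fU x) => y _ <-.
by case E: (f x) => [y|]; [exists y|case: (fU x)].
Qed.

Lemma same_all f x y : cellidx s (f x) = cellidx s (f y) ->
  (forall c, coord s (f x) c = coord s (f y) c) -> f x = f y.
Proof.
move=> xy cxy; rewrite -(coordK s (f x)) -(coordK s (f y)) xy.
by congr of_coord; apply: funext.
Qed.

(** Agreement in the last coordinate of the cell is agreement. *)
Lemma same_last f x y c : ((cdim (cellidx s (f x))).-1 <= c)%N ->
  same f x y c -> f x = f y.
Proof.
move=> lc [xy cxy]; apply: same_all => // c'.
have [cc|cc] := leqP c' c; first exact: cxy.
have dc : (cdim (cellidx s (f x)) <= c')%N.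
  by rewrite (leq_trans (leqSpred _)) // (leq_ltn_trans lc).
by rewrite !coord_out // -xy.
Qed.

Hypothesis s_pt : is_only_zero_cell s None.

(** The last coordinates of the points are pairwise distinct classes, and so
    are the other coordinates of a single point. *)
Lemma tdim_ge f x : Conf setT f ->
  (#|N| + (cdim (cellidx s (f x))).-1 <= tdim (typ f))%N.
Proof.
move=> /configP[fi fN].
have /boolp.choice[last lastP] y : exists c : 'I_D, c.+1 = cdim (cellidx s (f y)).
  have d0 := cdim_gt0 s_pt (fN y).
  have lt1 : ((cdim (cellidx s (f y))).-1 < D)%N.
    by rewrite (leq_trans _ (cdim_le (cellidx s (f y)))) // prednK.
  by exists (Ordinal lt1); rewrite /= prednK.
set k := (cdim _).-1.
have kD : (k <= D)%N by rewrite (leq_trans (leq_pred _)) // cdim_le.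
pose h (a : N + 'I_k) : N * 'I_D :=
  match a with inl y => class_rep (typ f) (y, last y)
  | inr j => class_rep (typ f) (x, widen_ord kD j) end.
have hE y (j : 'I_k) : h (inl y) <> h (inr j).
  move=> /class_rep_eqP[yj [yx _]]; have := lastP y; rewrite yj yx /= => E.
  have kE : k = j := esym (congr1 predn E).
  by have := ltn_ord j; rewrite -kE ltnn.
have hi : injective h.
  move=> [y|j] [y'|j'] //; [|by move/hE|by move/esym/hE|].
    move=> /class_rep_eqP[_ yy]; congr inl; apply: fi.
    by apply: same_last yy; rewrite -(lastP y).
  by move=> /class_rep_eqP[/(congr1 val)/= jj _]; congr inr; exact: val_inj.
have <- : #|{: N + 'I_k}| = (#|N| + k)%N by rewrite card_sum card_ord.
rewrite -(fintype.card_image hi); apply: subset_leq_card.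
apply/fintype.subsetP => _ /fintype.imageP[a _ ->].
case: a => [y|j] /=; apply: class_rep_in; rewrite /valid /= tlabelE.
  by rewrite -(lastP y).
by rewrite (leq_trans (ltn_ord j)) // leq_pred.
Qed.

(** A point of a 1-cell has a single coordinate. *)
Lemma tdim_lines f : (forall x, cdim (cellidx s (f x)) = 1%N) ->
  (tdim (typ f) <= #|N|)%N.
Proof.
move=> f1; have fst_inj : {in class_reps (typ f) &, injective (fun p => p.1)}.
  have c0 p : p \in class_reps (typ f) -> (p.2 : nat) = 0%N.
    by rewrite !inE /valid tlabelE f1 ltnS leqn0 => /andP[/eqP].
  move=> [x c] [y e] /c0 /= c0' /c0 /= e0 /= xy; congr (_, _) => //.
  by apply: val_inj; rewrite /= c0' e0.
by rewrite /tdim -(card_in_image fst_inj) max_card.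
Qed.

(** The factor makes this the lexicographic order: the number of free
    coordinates is at most that of all pairs of a point and a coordinate. *)
Definition rank t : nat :=
  ((\sum_x cdim (tlabel t x)) * #|{: N * 'I_D}|.+1 + tdim t)%N.

Lemma rank_lt_label t t' :
  (forall x, (cdim (tlabel t x) <= cdim (tlabel t' x))%N) ->
  (exists x, (cdim (tlabel t x) < cdim (tlabel t' x))%N) ->
  (rank t < rank t')%N.
Proof.
move=> le_tt [x lt_tt]; rewrite /rank.
have H : (\sum_x cdim (tlabel t x) < \sum_x cdim (tlabel t' x))%N.
  rewrite (bigD1 x) //= [ltnRHS](bigD1 x) //= -addSn leq_add //.
  by apply: leq_sum => y _.
rewrite (leq_trans _ (leq_addr _ _)) //; apply: leq_trans (leq_mul H (leqnn _)).
by rewrite mulSn addnC ltn_add2r ltnS max_card.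
Qed.

Lemma rank_lt_tdim t t' : (forall x, tlabel t x = tlabel t' x) ->
  (tdim t < tdim t')%N -> (rank t < rank t')%N.
Proof.
move=> tt ?; rewrite /rank (eq_bigr _ (fun x _ => congr1 _ (tt x))).
by rewrite ltn_add2l.
Qed.

(** The classes of f are unions of classes of g, and two classes of g have been
    merged. *)
Lemma tdim_lt f g : (forall x, cellidx s (f x) = cellidx s (g x)) ->
  (forall x y c, same g x y c -> same f x y c) ->
  (exists x y c, before g x y c /\ same f x y c) ->
  (tdim (typ f) < tdim (typ g))%N.
Proof.
move=> fg gf [x [y [c [gxy fxy]]]].
have vE p : valid (typ f) p = valid (typ g) p by rewrite /valid !tlabelE fg.
have rgf p p' : class_rep (typ g) p = class_rep (typ g) p' ->
    class_rep (typ f) p = class_rep (typ f) p'.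
  by case: p p' => [a b] [a' b'] /class_rep_eqP[-> /gf H]; exact/class_rep_eqP.
have rfK p : p \in class_reps (typ f) -> class_rep (typ f) p = p.
  by rewrite !inE => /andP[_ /eqP].
have ri : {in class_reps (typ f) &, injective (class_rep (typ g))}.
  by move=> p p' /rfK {2}<- /rfK {2}<- /rgf.
rewrite /tdim -(card_in_image ri); apply: proper_card; apply/fintype.properP; split.
  apply/fintype.subsetP => _ /fintype.imageP[p + ->]; rewrite !inE => /andP[vp _].
  by apply: class_rep_in; rewrite -vE.
(* The two merged classes cannot both represent classes of f. *)
pose im := [seq class_rep (typ g) p | p in class_reps (typ f)].
have notboth : class_rep (typ g) (x, c) \in im ->
    class_rep (typ g) (y, c) \in im -> False.
  move=> /fintype.imageP[p pf pE] /fintype.imageP[p' pf' pE'].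
  have pp : p = p'.
    rewrite -(rfK p) // -(rfK p') // -(rgf _ _ pE) -(rgf _ _ pE').
    exact/class_rep_eqP.
  move: pE; rewrite pp -pE' => /class_rep_eqP[_ [_ /(_ c (leqnn _)) E]].
  by case: gxy => _ _; rewrite E ltxx.
have vx := before_valid gxy.
have vy : valid (typ g) (y, c).
  by move: vx; rewrite /valid /= !tlabelE; case: gxy => ->.
have [xi|xi] := boolP (class_rep (typ g) (x, c) \in im).
  exists (class_rep (typ g) (y, c)); first exact: class_rep_in.
  by apply/negP => /(notboth xi).
by exists (class_rep (typ g) (x, c)); first exact: class_rep_in.
Qed.

End types.
Arguments same {R U} s {N} f x y c.
Arguments before {R U} s {N} f x y c.

(** * The cell of a configuration *)

Section config_cells.
Variables (R : realType) (U : topologicalType).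
Local Notation Us := (one_point_compactification U).
Variable s : cell_structure R (set0 : set Us).
Variable N : finType.
Local Notation D := (maxdim s).
Local Notation comb_type := (comb_type s N).
Implicit Types (f : pt_power U N) (x y : N) (c : 'I_D) (p : N * 'I_D).

(** The free coordinate of the class of p, with default 0 for the padding
    coordinates. *)
Definition free_coord (t : comb_type) (v : 'rV[R]_(tdim t)) p : R :=
  \sum_(j < tdim t) if enum_val j == class_rep t p then v ord0 j else 0.

Definition position (t : comb_type) f0 (v : 'rV[R]_(tdim t)) x c : R :=
  coord s (f0 x) c + free_coord v (x, c).

Definition config (t : comb_type) f0 (v : 'rV[R]_(tdim t)) : pt_power U N :=
  fun x => of_coord (tlabel t x) (position f0 v x).

Section linear.
Variable t : comb_type.
Implicit Type v : 'rV[R]_(tdim t).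

Lemma free_coord_enum v j p : enum_val j = class_rep t p -> free_coord v p = v ord0 j.
Proof.
move=> jp; rewrite /free_coord (bigD1 j) //= jp eqxx big1 ?addr0 // => i ij.
by rewrite -jp (inj_eq enum_val_inj) (negbTE ij).
Qed.

Lemma free_coord_scale a v p : free_coord (a *: v) p = a * free_coord v p.
Proof.
rewrite /free_coord mulr_sumr; apply: eq_bigr => j _.
by case: ifP; rewrite ?mxE ?mulr0.
Qed.

Lemma free_coord_continuous p : continuous (fun v => free_coord v p).
Proof.
apply: (@continuous_big _ _ _ _ _ add_continuous) => j _.
by case: (_ == _); [exact: coord_continuous|exact: cst_continuous].
Qed.

End linear.

Section cell_of_type.
Variables (t : comb_type) (f0 : pt_power U N).
Hypotheses (tE : typ s f0 = t) (f0C : Conf setT f0).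
Hypothesis s_pt : is_only_zero_cell s None.
Implicit Type v : 'rV[R]_(tdim t).

Lemma label_base x : tlabel t x = cellidx s (f0 x).
Proof. by rewrite -tE tlabelE. Qed.

Lemma free_coord_valid p : valid t p -> exists2 j : 'I_(tdim t),
  enum_val j = class_rep t p & forall v, free_coord v p = v ord0 j.
Proof.
move=> vp; have rp : class_rep t p \in class_reps t.
  by move: vp; rewrite -tE => /class_rep_in.
exists (enum_rank_in rp (class_rep t p)); first by rewrite enum_rankK_in.
by move=> v; apply: free_coord_enum; rewrite enum_rankK_in.
Qed.

Lemma enum_class_reps (j : 'I_(tdim t)) : valid t (enum_val j) /\
  forall v, free_coord v (enum_val j) = v ord0 j.
Proof.
have /andP[vj /eqP rj] : class_reps t (enum_val j) := enum_valP j.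
by split => // v; apply: free_coord_enum.
Qed.

Lemma free_coord_invalid v p : ~~ valid t p -> free_coord v p = 0.
Proof.
move=> vp; rewrite /free_coord big1 // => j _; case: eqP => // jp.
have [+ _] := enum_class_reps j; rewrite jp -{1 2}tE valid_class_rep tE => vp'.
by rewrite vp' in vp.
Qed.

Lemma position_out v x c : (cdim (tlabel t x) <= c)%N -> position f0 v x c = 0.
Proof.
move=> xc; rewrite /position coord_out -?label_base // free_coord_invalid ?addr0 //.
by rewrite /valid -leqNgt.
Qed.

Lemma position_same v x y c c' : same s f0 x y c -> (c' <= c)%N ->
  position f0 v x c' = position f0 v y c'.
Proof.
move=> xy cc; rewrite /position; case: (xy) => _ -> //.
rewrite /free_coord; have -> // : class_rep t (x, c') = class_rep t (y, c').
by rewrite -tE; apply/class_rep_eqP; split => //; exact: same_le xy.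
Qed.

(** The cell consists of the positions in the open cubes satisfying the strict
    inequalities prescribed by the type. In the free coordinates, which vanish
    at f0, each of these inequalities becomes linear with right hand side 1. *)
Definition constraint (j : N * N * 'I_D + (N * 'I_D) * bool) v : R :=
  match j with
  | inl (x, y, c) => if tbefore t x y c then
      (free_coord v (x, c) - free_coord v (y, c)) /
      (coord s (f0 y) c - coord s (f0 x) c) else 0
  | inr (p, true) => free_coord v p / (1 - coord s (f0 p.1) p.2)
  | inr (p, false) => - free_coord v p / (1 + coord s (f0 p.1) p.2)
  end.

Definition cell_gauge v : R := \big[Num.max/0]_j constraint j v.

Lemma before_base x y c : tbefore t x y c -> before s f0 x y c.
Proof. by rewrite -tE => /tbeforeP. Qed.

Lemma coord_bounds x c : 0 < 1 - coord s (f0 x) c /\ 0 < 1 + coord s (f0 x) c.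
Proof. by have := coord_lt1 (s := s) (f0 x) c; rewrite ltr_norml => /andP[]; lra. Qed.

Lemma cell_gauge_lt1 v : cell_gauge v < 1 <->
  (forall x y c, before s f0 x y c -> position f0 v x c < position f0 v y c) /\
  (forall x c, `|position f0 v x c| < 1).
Proof.
rewrite /cell_gauge; split.
  move=> /bigmax_ltP[_ H]; split.
    move=> x y c xyc; have := H (inl (x, y, c)) isT; rewrite /= -{1}tE.
    case: tbeforeP => // _; case: (xyc) => _ _ xy.
    by rewrite ltr_pdivrMr ?subr_gt0 // mul1r /position; lra.
  move=> x c; have [c1 c2] := coord_bounds x c.
  have := H (inr ((x, c), true)) isT; have := H (inr ((x, c), false)) isT.
  rewrite /= !ltr_pdivrMr // !mul1r ltr_norml /position => h1 h2.
  by apply/andP; split; lra.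
move=> [H1 H2]; apply/bigmax_ltP; split => // -[[[x y] c]|[[x c] []]] _ /=.
- case: ifP => // /before_base xyc; have := H1 _ _ _ xyc; case: (xyc) => _ _ xy.
  by rewrite ltr_pdivrMr ?subr_gt0 // mul1r /position; lra.
- have [c1 c2] := coord_bounds x c; rewrite ltr_pdivrMr // mul1r.
  by have := H2 x c; rewrite ltr_norml /position => /andP[]; lra.
- have [c1 c2] := coord_bounds x c; rewrite ltr_pdivrMr // mul1r.
  by have := H2 x c; rewrite ltr_norml /position => /andP[]; lra.
Qed.

Lemma cell_gauge_le1 v : cell_gauge v <= 1 -> forall x c, `|position f0 v x c| <= 1.
Proof.
move=> /bigmax_leP[_ H] x c; have [c1 c2] := coord_bounds x c.
have := H (inr ((x, c), true)) isT; have := H (inr ((x, c), false)) isT.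
rewrite /= !ler_pdivrMr // !mul1r ler_norml /position => h1 h2.
by apply/andP; split; lra.
Qed.

Lemma cell_gauge_eq1 v : cell_gauge v = 1 ->
  (exists x c, `|position f0 v x c| = 1) \/
  exists x y c, before s f0 x y c /\ position f0 v x c = position f0 v y c.
Proof.
move=> v1; have v1' : cell_gauge v <= 1 by rewrite v1.
have v1'' : 1 <= cell_gauge v by rewrite v1.
have pos1 := cell_gauge_le1 v1'.
have cle j : constraint j v <= 1 by move/bigmax_leP: v1' => [_]; exact.
have /bigmax_geP[|[j _ jv]] := v1''; first by rewrite leNgt ltr01.
have {jv cle} : constraint j v = 1 by apply/le_anti; rewrite jv cle.
case: j => [[[x y] c]|[[x c] b]] /=.
  case: ifP => [/before_base xyc|_ /eqP]; last by rewrite eq_sym oner_eq0.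
  move=> E; right; exists x, y, c; split => //; case: xyc => _ _ xy.
  have d0 : coord s (f0 y) c - coord s (f0 x) c != 0 by rewrite subr_eq0 gt_eqF.
  move: E => /(congr1 (fun z => z * (coord s (f0 y) c - coord s (f0 x) c))).
  by rewrite divfK // mul1r /position; lra.
have [c1 c2] := coord_bounds x c.
move=> E; left; exists x, c; apply/le_anti; rewrite pos1 /=.
have : 1 <= position f0 v x c \/ position f0 v x c <= - 1; last first.
  by rewrite ler_normr => -[->//|H]; apply/orP; right; lra.
case: b E => E; [left|right].
  have : 1 <= free_coord v (x, c) / (1 - coord s (f0 x) c) by rewrite E.
  by rewrite ler_pdivlMr // /position; lra.
have : 1 <= - free_coord v (x, c) / (1 + coord s (f0 x) c) by rewrite E.
by rewrite ler_pdivlMr // /position; lra.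
Qed.

Lemma gauge_cell_gauge : gauge cell_gauge.
Proof.
split.
- have fc p := @free_coord_continuous t p.
  have divc (g : 'rV[R]_(tdim t) -> R) d :
      continuous g -> continuous (fun v => g v / d).
    move=> gc v; apply: (@continuousM _ _ g (fun=> d^-1)); first exact: gc.
    exact: cst_continuous.
  apply: (@continuous_big R _ Num.max 0 xpredT (@max_continuous _ R)) => j _.
  case: j => [[[x y] c]|[p []]] /=; last 2 first.
  - by apply: (divc (fun v => free_coord v p)); exact: fc.
  - apply: (divc (fun v => - free_coord v p)) => v.
    by apply: (@continuousN _ _ _ (fun v => free_coord v p)); exact: fc.
  rewrite /constraint; case: (tbefore t x y c); last exact: cst_continuous.
  apply: (divc (fun v => free_coord v (x, c) - free_coord v (y, c))) => v.
  apply: (@continuousB _ _ _ (fun v => free_coord v (x, c))); exact: fc.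
- move=> a v a0; rewrite /cell_gauge.
  elim/big_ind2: _ => [|u1 u2 w1 w2 -> ->|j _]; first by rewrite mulr0.
    by rewrite maxr_pMr.
  case: j => [[[x y] c]|[p []]] /=; last 2 first.
  + by rewrite free_coord_scale mulrA.
  + by rewrite free_coord_scale -mulrN mulrA.
  by case: ifP => _; rewrite ?mulr0 // !free_coord_scale -mulrBr mulrA.
- exists (1 / 2); first by lra.
  move=> v; have q0 : 0 <= cell_gauge v by exact: bigmax_ge_id.
  suff : `|v| <= 2 * cell_gauge v by lra.
  apply/rV_norm_le; first by lra.
  move=> j; have [_ <-] := enum_class_reps j; case: (enum_val j) => x c.
  have := coord_lt1 (s := s) (f0 x) c; rewrite ltr_norml => /andP[h1 h2].
  have [c1 c2] := coord_bounds x c.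
  have : constraint (inr ((x, c), true)) v <= cell_gauge v.
    exact: (le_bigmax _ (fun j => constraint j v)).
  have : constraint (inr ((x, c), false)) v <= cell_gauge v.
    exact: (le_bigmax _ (fun j => constraint j v)).
  rewrite /= !ler_pdivrMr // => H1 H2.
  have H3 : cell_gauge v * (1 + coord s (f0 x) c) <= cell_gauge v * 2.
    by rewrite ler_wpM2l //; lra.
  have H4 : cell_gauge v * (1 - coord s (f0 x) c) <= cell_gauge v * 2.
    by rewrite ler_wpM2l //; lra.
  by rewrite ler_norml; apply/andP; split; lra.
Qed.

Lemma config_coord v : (forall x c, `|position f0 v x c| < 1) ->
  (forall x, cellidx s (config f0 v x) = tlabel t x) /\
  forall x c, coord s (config f0 v x) c = position f0 v x c.
Proof.
move=> v1; have H x := of_coordK (v1 x) (position_out v (x := x)).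
by split => x; case: (H x).
Qed.

Lemma config_same v : (forall x c, `|position f0 v x c| < 1) ->
  forall x y c, same s f0 x y c -> same s (config f0 v) x y c.
Proof.
move=> /config_coord[l1 l2] x y c xy; split; first by rewrite !l1 !label_base; case: xy.
by move=> c' cc; rewrite !l2; exact: position_same xy cc.
Qed.

Section interior.
Variable v : 'rV[R]_(tdim t).
Hypothesis v1 : cell_gauge v < 1.

Let pos1 := (cell_gauge_lt1 v).1 v1.
Let label := (config_coord pos1.2).1.
Let crd := (config_coord pos1.2).2.

Let apart x y c : before s f0 x y c ->
  coord s (config f0 v x) c < coord s (config f0 v y) c.
Proof. by rewrite !crd; exact: pos1.1. Qed.

Lemma config_same_iff x y c : same s (config f0 v) x y c <-> same s f0 x y c.
Proof.
split; last exact/config_same/pos1.2.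
move=> [xy cxy]; have xy0 : cellidx s (f0 x) = cellidx s (f0 y).
  by rewrite -!label_base -!label.
split => // c' cc; apply: contrapT => /(before_total xy0)[e ec].
have /cxy E : (e <= c)%N by exact: leq_trans cc.
by move=> [] /apart; rewrite E ltxx.
Qed.

(** The type is determined by the inequalities: the coordinates of f0 that
    coincide are shared, and those that first differ stay in order. *)
Lemma config_before_iff x y c : before s (config f0 v) x y c <-> before s f0 x y c.
Proof.
split=> [[xy cxy lxy]|xyc]; last first.
  split; [|move=> c' cc|exact: apart]; case: (xyc) => xy cxy _.
    by rewrite !label !label_base.
  have : same s f0 x y c' by split => // e /leq_ltn_trans/(_ cc)/cxy.
  by move=> /config_same_iff[_ /(_ c' (leqnn _))].
have xy0 : cellidx s (f0 x) = cellidx s (f0 y) by rewrite -!label_base -!label.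
have cxy0 c' : (c' < c)%N -> coord s (f0 x) c' = coord s (f0 y) c'.
  move=> cc; have : same s (config f0 v) x y c'.
    by split => // e /leq_ltn_trans/(_ cc)/cxy.
  by move=> /config_same_iff[_ /(_ c' (leqnn _))].
split => //; case: (ltgtP (coord s (f0 x) c) (coord s (f0 y) c)) => // H.
  have /apart : before s f0 y x c by split => // c' /cxy0.
  by rewrite ltNge (ltW lxy).
have /config_same_iff[_ /(_ c (leqnn _)) E] : same s f0 x y c.
  by split => // c'; rewrite leq_eqVlt => /orP[/eqP/val_inj ->|/cxy0].
by move: lxy; rewrite E ltxx.
Qed.

Lemma config_typK : typ s (config f0 v) = t.
Proof.
rewrite -[RHS]tE; apply: typ_eq; [|exact: config_same_iff|exact: config_before_iff].
by move=> x; rewrite label label_base.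
Qed.

Lemma config_Conf : Conf setT (config f0 v).
Proof.
move/configP: f0C => [f0i f0N]; apply/configP.
split => [x y xy|x /(congr1 (cellidx s))].
  apply: f0i; apply: (@same_all _ _ s).
    by rewrite -!label_base -!label xy.
  move=> c; have /config_same_iff[_ H] : same s (config f0 v) x y c by rewrite /same xy.
  exact: H.
rewrite label label_base => /(cellidx_None s_pt); exact: f0N.
Qed.

End interior.

Lemma config_inj v w : cell_gauge v < 1 -> cell_gauge w < 1 ->
  config f0 v = config f0 w -> v = w.
Proof.
move=> /cell_gauge_lt1[_ /config_coord[_ hv]] /cell_gauge_lt1[_ /config_coord[_ hw]] vw.
apply/rowP => j; have [_ jE] := enum_class_reps j; rewrite -!jE.
case: (enum_val j) => x c; have := hv x c; rewrite vw hw /position.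
by move=> /addrI.
Qed.

Lemma config_surj f : Conf setT f -> typ s f = t ->
  exists2 v, cell_gauge v < 1 & config f0 v = f.
Proof.
move=> fC ft; have lab x : cellidx s (f x) = tlabel t x by rewrite -ft tlabelE.
have sameE x y c : same s f x y c <-> same s f0 x y c.
  by split => /tsameP; rewrite ?ft -?tE => H; apply/tsameP; rewrite ?ft -?tE.
pose v : 'rV[R]_(tdim t) := \row_j (coord s (f (enum_val j).1) (enum_val j).2 -
  coord s (f0 (enum_val j).1) (enum_val j).2).
have pos x c : position f0 v x c = coord s (f x) c.
  have [xc|xc] := boolP (valid t (x, c)); last first.
    by rewrite position_out ?coord_out // ?lab leqNgt.
  rewrite /position; have [j jr ->] := free_coord_valid xc; rewrite mxE jr.
  have xr : same s f0 x (class_rep t (x, c)).1 c.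
    by rewrite -tE; exact: (class_rep_same f0 (x, c)).
  have [_ -> //] := xr; have [_ <- //] := (sameE _ _ _).2 xr.
  by rewrite subrKC.
exists v.
  apply/cell_gauge_lt1; split => [x y c|x c]; last by rewrite pos coord_lt1.
  rewrite !pos => xyc; have : before s f x y c.
    by apply/tbeforeP; rewrite ft -tE; apply/tbeforeP.
  by case.
apply: funext => x; rewrite /config -[RHS](coordK s) lab.
by congr of_coord; apply: funext => c; exact: pos.
Qed.

Lemma config_continuous :
  {within [set v | cell_gauge v <= 1], continuous (@config t f0)}.
Proof.
apply: within_prod_topology => x; apply: of_coord_continuous => [c|v c v1].
  apply: continuous_subspaceT => v.
  apply: (@continuousD _ _ _ (fun=> coord s (f0 x) c) (fun v => free_coord v (x, c))).
    exact: cst_continuous.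
  exact: free_coord_continuous.
exact: cell_gauge_le1.
Qed.

(** On the boundary of the polytope a point reaches the boundary of its cell,
    or else the type degenerates within the same cells by identifying two
    coordinates. *)
Lemma config_boundary v : is_CW_complex s -> cell_gauge v = 1 ->
  (rank (typ s (config f0 v)) < rank t)%N.
Proof.
move=> s_CW v1; have v1' : cell_gauge v <= 1 by rewrite v1.
have pos1 := cell_gauge_le1 v1'.
have [[x [c xc]]|noB] := pselect (exists x c, `|position f0 v x c| = 1).
  apply: rank_lt_label => [y|]; first by rewrite tlabelE; exact: of_coord_dim.
  exists x; rewrite tlabelE; apply: (of_coord_dim_lt (c := c)) => //.
  rewrite ltnNge; apply/negP => /(position_out v) p0.
  by move: xc; rewrite p0 normr0 => /esym/eqP; rewrite oner_eq0.
have pos1' x c : `|position f0 v x c| < 1.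
  by rewrite lt_neqAle pos1 andbT; apply/eqP => xc; apply: noB; exists x, c.
have [l1 l2] := config_coord pos1'.
apply: rank_lt_tdim => [x|]; first by rewrite tlabelE l1.
have -> : tdim t = tdim (typ s f0) by rewrite tE.
apply: tdim_lt.
- by move=> x; rewrite l1 label_base.
- exact: config_same.
- case: (cell_gauge_eq1 v1) => // -[x [y [c [xyc E]]]].
  exists x, y, c; split => //; case: (xyc) => xy cxy _; split.
    by rewrite !l1 !label_base.
  move=> c'; rewrite leq_eqVlt => /orP[/eqP/val_inj ->|cc]; first by rewrite !l2.
  have /(config_same pos1')[_ ] : same s f0 x y c'.
    by split => // e /leq_ltn_trans/(_ cc)/cxy.
  by apply.
Qed.

End cell_of_type.
End config_cells.

(** * Connected components and weak topology *)

(** Finitely many disjoint connected sets closed in their union are its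
    connected components: each is also open in the union. *)
Lemma connected_component_cells (X : topologicalType) (I : finType) (P : set I)
    (E C : I -> set X) (S : set X) :
  S = \bigcup_(i in P) E i -> trivIset P E ->
  (forall i, P i -> connected (E i)) ->
  (forall i, P i -> closed (C i)) ->
  (forall i, P i -> E i = S `&` C i) ->
  forall i x, P i -> E i x -> connected_component S x = E i.
Proof.
move=> SE tE cE clC EC i x Pi Eix; apply/seteqP; split; last first.
  apply: connected_component_max => //; last exact: cE.
  by move=> y Eiy; rewrite SE; exists i.
move=> y [B [Bx BS cB] By]; suff BE : B `&` E i = B.
  by move: By; rewrite -BE => -[].
apply: cB; first by exists x.
  exists (~` \bigcup_(j in P `\ i) C j).
    apply: closed_openC; apply: closed_bigcup; first exact: finite_finset.
    by move=> j [Pj _]; exact: clC.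
  (* The other sets cover the rest of S. *)
  apply/seteqP; split => z [Bz Eiz]; split => //.
    move=> [j [Pj ji] Cjz]; apply: ji; apply: (tE _ _ Pj Pi); exists z; split => //.
    by rewrite EC //; split => //; exact: BS.
  have := BS _ Bz; rewrite {1}SE => -[j Pj Ejz].
  have [<-//|ji] := pselect (j = i); case: Eiz; exists j => //.
  by move: Ejz; rewrite EC // => -[].
exists (C i); first exact: clC.
by rewrite EC // setIA (setIidl BS).
Qed.

Lemma star_connected (R : realType) n (q : 'rV[R]_n -> R) : gauge q ->
  connected [set v | q v < 1].
Proof.
move=> gq.
have -> : [set v | q v < 1] =
    \bigcup_(v in [set v | q v < 1]) ((fun a : R => a *: v) @` `[0, 1]%classic).
  apply/seteqP; split => [v v1|w [v /= v1 [a /= + <-]]].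
    by exists v => //; exists 1; rewrite ?scale1r //= in_itv /= lexx ler01.
  rewrite in_itv /= => /andP[a0 a1]; rewrite gauge_scale //.
  apply: le_lt_trans v1; rewrite -[leRHS]mul1r ler_wpM2r //; exact: gauge_ge0.
apply: bigcup_connected.
  by exists 0 => v _; exists 0; rewrite ?scale0r //= in_itv /= lexx ler01.
move=> v _; apply: connected_continuous_connected; first exact: segment_connected.
by apply: continuous_subspaceT => a; apply: cvgZr_tmp; exact: cvg_id.
Qed.

(** A set is the union of its traces on the subspace and on the closed cells,
    which are compact. *)
Lemma closed_of_cells (R : realType) (X : topologicalType) (A : set X) (m : nat)
    (d : 'I_m -> nat) (chi : forall i, 'rV[R]_(d i) -> X) :
  hausdorff_space X ->
  (forall i, {within disk R (d i), continuous (@chi i)}) ->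
  ~` A `<=` \bigcup_i (@chi i @` disk R (d i)) ->
  forall C : set X, closed (A `&` C) ->
  (forall i, closed (disk R (d i) `&` (@chi i @^-1` C))) -> closed C.
Proof.
move=> hX chic cov C AC dC.
have -> : C = (A `&` C) `|`
    \bigcup_(i in setT) (@chi i @` (disk R (d i) `&` @chi i @^-1` C)).
  apply/seteqP; split => [y Cy|y [[]//|[i _ [v [_ Cv] <-]]]] //.
  have [Ay|/cov[i _ [v Dv vy]]] := pselect (A y); first by left.
  by right; exists i => //; exists v => //; split => //=; rewrite vy.
apply: closedU => //; apply: closed_bigcup; first exact: finite_finset.
move=> i _; apply: compact_closed => //; apply: continuous_compact.
  by apply: continuous_subspaceW (chic i) => v [].
by apply: subclosed_compact (dC i) (disk_compact (n := d i)) _ => v [].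
Qed.

(** * The power as a relative cell complex *)

Section power.
Variables (R : realType) (U : topologicalType).
Local Notation Us := (one_point_compactification U).
Variable s : cell_structure R (set0 : set Us).
Hypotheses (s_CW : is_CW_complex s) (s_pt : is_only_zero_cell s None).
Variable N : finType.
Implicit Types (f : pt_power U N) (x y : N).

Lemma pt_power_hausdorff : hausdorff_space (pt_power U N).
Proof. by apply: hausdorff_product => _; case: s_CW. Qed.

Lemma closed_DN : closed (DN U N).
Proof.
have eval_cont x : continuous (fun f : pt_power U N => f x).
  exact: (@proj_continuous N (fun=> Us) x).
have hU : hausdorff_space Us by case: s_CW.
have eq_closed x y : closed [set f : pt_power U N | f x = f y].
  move=> f fcl; apply: hU => A B Afx Bfy.
  have nA : nbhs f [set g : pt_power U N | A (g x)] by exact: (eval_cont x).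
  have nB : nbhs f [set g : pt_power U N | B (g y)] by exact: (eval_cont y).
  have [g [/= gxy [Ag Bg]]] := fcl _ (filterI nA nB).
  by exists (g x); split => //=; rewrite gxy.
have None_closed x : closed [set f : pt_power U N | f x = None].
  apply: (@preimage_closed _ _ (fun f : pt_power U N => f x) [set None]) => //.
  exact/accessible_closed_set1/hausdorff_accessible.
have -> : DN U N =
    \bigcup_(x in setT) [set f : pt_power U N | f x = None] `|`
    \bigcup_(p in [set p : N * N | p.1 <> p.2]) [set f : pt_power U N | f p.1 = f p.2].
  apply/seteqP; split => f; last first.
    by case=> [[x _ fx]|[p pP fp]] /configP[fi fN]; [exact: (fN x)|exact/pP/fi].
  move=> fD; apply: contrapT => nf; apply: fD; apply/configP; split.
    by move=> x y xy; apply: contrapT => nxy; apply: nf; right; exists (x, y).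
  by move=> x fx; apply: nf; left; exists x.
by apply: closedU; apply: closed_bigcup => //; exact: finite_finset.
Qed.

Definition occurs (t : comb_type s N) : bool :=
  `[< exists f, Conf setT f /\ typ s f = t >].

(** Only the types of configurations give cells, and they are attached by
    increasing rank. *)
Definition occurring_types : seq (comb_type s N) :=
  sort (fun t t' => rank t <= rank t')%N (enum occurs).

Definition base (t : comb_type s N) : pt_power U N :=
  xget ((fun=> None) : pt_power U N) [set f | Conf setT f /\ typ s f = t].

Implicit Types i j : 'I_(size occurring_types).

Definition type_of i : comb_type s N := tnth (in_tuple occurring_types) i.

Lemma base_of i : Conf setT (base (type_of i)) /\ typ s (base (type_of i)) = type_of i.
Proof.
have : type_of i \in occurring_types by exact: mem_tnth.
rewrite mem_sort mem_enum => /asboolP tP.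
exact: (xgetPex ((fun=> None) : pt_power U N) tP).
Qed.

Let baseC i := (base_of i).1.
Let baseE i := (base_of i).2.

Lemma type_ofP f : Conf setT f -> exists i, typ s f = type_of i.
Proof.
move=> fC; have : typ s f \in occurring_types.
  by rewrite mem_sort mem_enum; apply/asboolP; exists f.
by move=> /(tnthP (in_tuple occurring_types)).
Qed.

Lemma type_of_inj : injective type_of.
Proof.
by apply/tuple_uniqP; rewrite sort_uniq enum_uniq.
Qed.

Lemma rank_lt_index i j : (rank (type_of i) < rank (type_of j))%N -> (i < j)%N.
Proof.
apply: contraLR; rewrite -!leqNgt => ji; rewrite /type_of !(tnth_nth (type_of i)) /=.
pose leT (t t' : comb_type s N) := (rank t <= rank t')%N.
have leT_total : total leT by move=> a b; exact: leq_total.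
have leT_trans : transitive leT by move=> a b c; exact: leq_trans.
have leT_refl : reflexive leT by move=> a; exact: leqnn.
apply: (sorted_leq_nth leT_trans leT_refl (type_of i) (sort_sorted leT_total _)).
all: by rewrite ?inE.
Qed.

Definition config_gauge i := @cell_gauge R U s N (type_of i) (base (type_of i)).

Lemma gauge_config i : gauge (@config_gauge i).
Proof. exact: gauge_cell_gauge. Qed.

Definition config_map i (v : 'rV[R]_(tdim (type_of i))) : pt_power U N :=
  config (base (type_of i)) (radial (@enorm R _) (@config_gauge i) v).

Let gauge_radial i (v : 'rV[R]_(tdim (type_of i))) :
  config_gauge (radial (@enorm R _) (@config_gauge i) v) = enorm v.
Proof. exact: radial_gauge (gauge_enorm R _) (gauge_config i) v. Qed.

Lemma config_map_continuous i :
  {within disk R (tdim (type_of i)), continuous (@config_map i)}.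
Proof.
apply: (within_comp _ _ (@config_continuous _ _ _ _ (type_of i) (base (type_of i)))).
  by move=> _ [v /disk_enorm v1 <-] /=; rewrite -/(config_gauge _) gauge_radial.
apply: continuous_subspaceT.
exact: radial_continuous (gauge_enorm R _) (gauge_config i).
Qed.

Lemma config_map_inj i :
  set_inj (open_disk R (tdim (type_of i))) (@config_map i).
Proof.
move=> v w /set_mem/open_disk_enorm v1 /set_mem/open_disk_enorm w1 vw.
apply: (can_inj (radialK (gauge_enorm R _) (gauge_config i))).
by apply: (config_inj (baseE i) _ _ vw); rewrite -/(config_gauge _) gauge_radial.
Qed.

Lemma config_mapE i : @config_map i @` open_disk R (tdim (type_of i)) =
  [set f | Conf setT f /\ typ s f = type_of i].
Proof.
apply/seteqP; split => [_ [v /open_disk_enorm v1 <-]|f [fC fE]].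
  split; first apply: (config_Conf (baseE i) (baseC i) s_pt).
    by rewrite -/(config_gauge _) gauge_radial.
  by apply: (config_typK (baseE i)); rewrite -/(config_gauge _) gauge_radial.
have [v v1 vf] := config_surj (baseE i) fC fE.
exists (radial (@config_gauge i) (@enorm R _) v).
  apply/open_disk_enorm.
  by rewrite (radial_gauge (gauge_config i) (gauge_enorm R _)).
by rewrite /config_map (radialK (gauge_config i) (gauge_enorm R _)).
Qed.

Lemma config_map_boundary i v : sphere R _ v ->
  (rank (typ s (@config_map i v)) < rank (type_of i))%N.
Proof.
move=> /sphere_enorm v1; apply: (config_boundary (baseE i)) => //.
by rewrite -/(config_gauge _) gauge_radial.
Qed.

Lemma config_maps_disjoint :
  trivIset setT (fun i => @config_map i @` open_disk R (tdim (type_of i))).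
Proof.
move=> i j _ _ [f []]; rewrite !config_mapE => -[_ fi] [_ fj].
by apply: type_of_inj; rewrite -fi.
Qed.

Lemma config_maps_cover :
  \bigcup_i (@config_map i @` open_disk R (tdim (type_of i))) = ~` DN U N.
Proof.
rewrite /DN setCK; apply/seteqP; split => [f [i _]|f fC].
  by rewrite config_mapE => -[].
by have [i fi] := type_ofP fC; exists i => //; rewrite config_mapE.
Qed.

Lemma config_maps_weak (C : set (pt_power U N)) : closed (DN U N `&` C) ->
  (forall i, closed (disk R (tdim (type_of i)) `&` (@config_map i @^-1` C))) ->
  closed C.
Proof.
apply: closed_of_cells; [exact: pt_power_hausdorff|exact: config_map_continuous|].
rewrite -config_maps_cover => f [i _ [v /open_disk_enorm v1 <-]]; exists i => //.
by exists v => //; apply/disk_enorm; exact/ltW.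
Qed.

Definition power_structure : cell_structure R (DN U N) :=
  CellStructure config_map_continuous config_map_inj config_maps_disjoint
    config_maps_cover closed_DN config_maps_weak.

Lemma power_cellE (i : 'I_(ncells power_structure)) :
  cell i = [set f | Conf setT f /\ typ s f = type_of i].
Proof. exact: config_mapE. Qed.

(** A boundary point which is a configuration lies in the cell of its own type,
    which has lower rank. *)
Lemma power_is_cell_complex : is_cell_complex power_structure.
Proof.
move=> i _ [v vS <-]; set f := charmap _.
have [fC|fD] := pselect (Conf setT f); last by left.
right; have [j fj] := type_ofP fC; exists j; last by rewrite power_cellE.
by apply: rank_lt_index; rewrite -fj; exact: config_map_boundary.
Qed.

Lemma tdim_ge_card f : Conf setT f -> (#|N| <= tdim (typ s f))%N.
Proof.
move=> fC; have [N0|/card_gt0P[x _]] := posnP #|N|; first by rewrite N0.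
exact: leq_trans (leq_addr _ _) (tdim_ge s_pt x fC).
Qed.

Lemma tdim_eq_card f : Conf setT f ->
  tdim (typ s f) = #|N| <-> forall x, cdim (cellidx s (f x)) = 1%N.
Proof.
move=> fC; split=> [E x|f1]; last first.
  by apply/eqP; rewrite eqn_leq tdim_ge_card // tdim_lines.
have := tdim_ge s_pt x fC; rewrite E -[leqRHS]addn0 leq_add2l leqn0 => /eqP d1.
have fx : f x <> None by move/configP: fC => [_]; exact.
by rewrite -(prednK (cdim_gt0 s_pt fx)) d1.
Qed.

Lemma Conf_skeleton f d : Conf setT f ->
  (forall x, (cdim (cellidx s (f x)) <= d)%N) -> Conf (skeleton s d) f.
Proof.
move=> [fi fU] fd; split => // x; have [y _ yx] := fU x; exists y => //.
by rewrite /skeleton /= yx; exists (cellidx s (f x)); [exact: fd|exact: cellidxP].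
Qed.

Lemma Conf_one_cells f :
  Conf (one_cells s) f <-> Conf setT f /\ forall x, cdim (cellidx s (f x)) = 1%N.
Proof.
split=> [[fi f1]|[[fi fU] f1]].
  split; first by split => // x; have [y _ <-] := f1 x; exists y.
  by move=> x; have [y [i /= i1 iy] <-] := f1 x; rewrite (cellidx_uniq iy).
split => // x; have [y _ yx] := fU x; exists y => //.
by rewrite /one_cells /= yx; exists (cellidx s (f x)); [exact: f1|exact: cellidxP].
Qed.

Lemma rank_one_cells f : Conf (one_cells s) f ->
  rank (typ s f) = (#|N| * #|{: N * 'I_(maxdim s)}|.+1 + #|N|)%N.
Proof.
move=> /Conf_one_cells[fC f1]; rewrite /rank (tdim_eq_card fC).2 //.
congr (_ * _ + _)%N; rewrite -[RHS]sum1_card; apply: eq_bigr => x _.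
by rewrite tlabelE f1.
Qed.

(** All n-cells have the same rank, so the boundary of each of them avoids the
    others. *)
Lemma one_cells_component (i : 'I_(ncells power_structure)) f :
  cdim i = #|N| -> cell i f ->
  connected_component (Conf (one_cells s)) f = cell i.
Proof.
pose P := [set i : 'I_(ncells power_structure) | cdim i = #|N|].
have PE (j : 'I_(ncells power_structure)) (g : pt_power U N) :
    P j -> cell j g -> Conf (one_cells s) g.
  rewrite power_cellE => jn [gC gj]; apply/Conf_one_cells; split => //.
  by apply/tdim_eq_card => //; rewrite gj.
move=> iN fi; apply: (connected_component_cells (P := P)
  (E := @cell _ _ _ power_structure)
  (C := fun i => @config_map i @` disk R (tdim (type_of i))) _ _ _ _ _ iN fi).
- apply/seteqP; split => [g /[dup] gS /Conf_one_cells[gC g1]|g [j Pj]]; last exact: PE.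
  have [j gj] := type_ofP gC; exists j; last by rewrite power_cellE.
  by rewrite /P /= -gj; apply/tdim_eq_card.
- by move=> j k _ _; exact: config_maps_disjoint.
- move=> j _; have -> : cell j =
      config (base (type_of j)) @` [set v | @config_gauge j v < 1].
    rewrite power_cellE; apply/seteqP; split => [g [gC gj]|_ [v v1 <-]].
      by have [v v1 vg] := config_surj (baseE j) gC gj; exists v.
    split; first exact: (config_Conf (baseE j) (baseC j) s_pt).
    exact: (config_typK (baseE j)).
  apply: connected_continuous_connected.
    exact: star_connected (gauge_config j).
  apply: continuous_subspaceW (@config_continuous _ _ _ _ (type_of j) _).
  by move=> v /= /ltW.
- move=> j _; apply: compact_closed; first exact: pt_power_hausdorff.
  by apply: continuous_compact; [exact: config_map_continuous|exact: disk_compact].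
- move=> j Pj; apply/seteqP; split => [g gj|g [+ [v vD vg]]]; last rewrite -vg => gS.
    split; first exact: PE gj.
    by case: gj => v /open_disk_enorm v1 <-; exists v => //; apply/disk_enorm/ltW.
  move: vD => /disk_enorm; rewrite le_eqVlt => /orP[/eqP v1|v1]; last first.
    by exists v => //; apply/open_disk_enorm.
  have /(@config_map_boundary j) : sphere R _ v by apply/sphere_enorm.
  rewrite rank_one_cells // -(baseE j) rank_one_cells ?ltnn //.
  by apply: (PE j) => //; rewrite power_cellE.
Qed.

End power.

Unset Implicit Arguments.
Set Strict Implicit.

Theorem theorem1p2 (R : realType) (U : topologicalType)
    (s : cell_structure R (set0 : set (one_point_compactification U)))
    (s_CW : is_CW_complex s)
    (s_pt : is_only_zero_cell s None)
    (N : finType) (n : nat) (card_N : #|N| = n) :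
  connected_pair R (n%:Z - 1) (DN U N) /\
  exists t : cell_structure R (DN U N),
    [/\ is_cell_complex t,
        forall i : 'I_(ncells t), (n <= cdim i)%N,
        [set cell i | i in [set i : 'I_(ncells t) | cdim i = n]] =
          [set connected_component (Conf (N := N) (one_cells s)) f
            | f in Conf (N := N) (one_cells s)] &
        forall (d : nat) (i : 'I_(ncells t)), cdim i = (n + d)%N ->
          cell i `<=` Conf (N := N) (skeleton s d.+1)].
Proof.
subst n; pose t := power_structure s_CW s_pt N.
have dimt (i : 'I_(ncells t)) : cdim i = tdim (type_of i) by [].
have cellE (i : 'I_(ncells t)) : cell i = [set f | Conf setT f /\ typ s f = type_of i].
  exact: power_cellE.
have repr (i : 'I_(ncells t)) : exists2 f, cell i f & Conf setT f.
  by have [? ?] := base_of i; exists (base (type_of i)); rewrite ?cellE.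
have t_cc : is_cell_complex t by exact: power_is_cell_complex.
have t_dim (i : 'I_(ncells t)) : (#|N| <= cdim i)%N.
  have [f + fC] := repr i; rewrite cellE => -[_ fi].
  by rewrite dimt -fi; exact: tdim_ge_card.
split.
  apply: (connected_pair_cell_complex _ t_cc t_dim).
  exact: (pt_power_hausdorff s_CW).
exists t; split => //.
  apply/seteqP; split => [_ [i /= iN <-]|_ [f f1 <-]].
    have [f fi fC] := repr i; exists f; last exact: one_cells_component.
    apply/Conf_one_cells; split => //; apply/tdim_eq_card => //.
    by move: fi; rewrite cellE => -[_ ->].
  have [fC fd] := (Conf_one_cells s f).1 f1.
  have [i fi] := type_ofP s fC.
  have iN : cdim (c := t) i = #|N| by rewrite dimt -fi; exact/tdim_eq_card.
  by exists i => //; apply: esym; apply: one_cells_component => //; rewrite cellE.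
move=> d i id f; rewrite cellE => -[fC fi]; apply: Conf_skeleton => // x.
have := tdim_ge s_pt x fC; rewrite fi -dimt id leq_add2l.
by move=> xd; rewrite (leq_trans (leqSpred _)).
Qed.
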